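(* Let $k$ be a field of characteristic $0$, let $X\subset\mathbb{A}^q\times\mathbb{A}^r$ be an affine variety, and let $S\subset k$ be a nonempty finite subset. Let $\pi\colon\mathbb{A}^q\times\mathbb{A}^r\to\mathbb{A}^r$ be the projection. Then the number of points $\bm{a}=(a_1,\ldots,a_r)\in S^r\subset\mathbb{A}^r$ such that $$\text{the projection of } X \text{ to } \mathbb{A}^r \text{ is dominant}\iff \text{the fiber over } \bm{a} \text{ of the projection } X\to\mathbb{A}^r \text{ is nonempty}$$ is at least $$\left(1-\frac{\deg X}{|S|}\right)\cdot|S|^r.$$
   Context: Affine varieties are (possibly reducible) zero sets of polynomials with coefficients in $k$, identified with their sets of $\overline{k}$-points, where $\overline{k}$ is the algebraic closure of $k$; so $\mathbb{A}^n=\overline{k}^n$. The projection of $X$ is dominant if $\overline{\pi(X)}=\mathbb{A}^r$ (Zariski closure). The fiber over $\bm{a}$ is $\pi^{-1}(\bm{a})\cap X$. $\deg X$ is the degree in the sense of Heintz: the degree of an irreducible affine variety $X$ is the maximal finite number of intersection points of $X$ with an affine linear subspace of codimension $\dim X$, and the degree of a variety is the sum of the degrees of all its irreducible components. *)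

(* Defs.v *)
From HB Require Import structures.
From mathcomp Require Import all_boot all_order all_algebra.
From mathcomp Require Import finmap.
From mathcomp Require Import boolp classical_sets cardinality.
From mathcomp Require Import mpoly.

Set Implicit Arguments.
Unset Strict Implicit.
Unset Printing Implicit Defensive.

Import Order.TTheory GRing.Theory Num.Theory.

Local Open Scope classical_set_scope.
Local Open Scope card_scope.
Local Open Scope ring_scope.

(* Throughout, an algebraic closure of k is an algebraically closed field K
   with an embedding f : k -> K over which K is algebraic.  The affine space
   A^n is K^n = 'rV[K]_n, and A^q x A^r is 'rV[K]_(q + r). *)
Definition is_algebraic_closure (k : fieldType) (K : closedFieldType)
    (f : {rmorphism k -> K}) : Prop :=
  forall x : K, algebraicOver f x.

Section Varieties.

Variables (k : fieldType) (K : closedFieldType) (f : {rmorphism k -> K}).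

(* Varieties are zero sets in K^n of polynomials with coefficients in k; the
   notions below (irreducibility, components, closure) refer to them. *)
Definition affine_variety (n : nat) (X : set 'rV[K]_n) : Prop :=
  exists I : set {mpoly k[n]},
    X = [set x | forall p, I p -> (map_mpoly f p).@[x 0] = 0].

Definition zariski_closure (n : nat) (A : set 'rV[K]_n) : set 'rV[K]_n :=
  [set x | forall Y, affine_variety Y -> A `<=` Y -> Y x].

Definition irreducible (n : nat) (X : set 'rV[K]_n) : Prop :=
  [/\ affine_variety X, X !=set0 &
      forall Y Z, affine_variety Y -> affine_variety Z ->
        X = Y `|` Z -> X = Y \/ X = Z].

Definition irreducible_component (n : nat) (X Z : set 'rV[K]_n) : Prop :=
  [/\ irreducible Z, Z `<=` X &
      forall Z', irreducible Z' -> Z' `<=` X -> Z `<=` Z' -> Z' = Z].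

Definition irreducible_chain (n : nat) (X : set 'rV[K]_n) (d : nat)
    (Z : nat -> set 'rV[K]_n) : Prop :=
  [/\ forall i, (i <= d)%N -> irreducible (Z i),
      forall i, (i <= d)%N -> Z i `<=` X &
      forall i, (i < d)%N -> Z i `<` Z i.+1].

Definition has_dimension (n : nat) (X : set 'rV[K]_n) (d : nat) : Prop :=
  (exists Z, irreducible_chain X d Z) /\
  (forall m Z, irreducible_chain X m Z -> (m <= d)%N).

(* The translate by p of the row space of U. *)
Definition linear_subspace_of_codim (n c : nat) (L : set 'rV[K]_n) : Prop :=
  exists (p : 'rV[K]_n) (U : 'M[K]_n),
    (\rank U + c = n)%N /\ L = [set x | (x - p <= U)%MS].

(* Meaningful for irreducible X.  Only those L meeting X in finitely many points
   are compared; X may also meet some L of codimension dim X in infinitely many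
   points. *)
Definition has_irreducible_degree (n : nat) (X : set 'rV[K]_n) (e : nat) :
    Prop :=
  exists2 d : nat, has_dimension X d &
    (exists2 L, linear_subspace_of_codim d L & X `&` L #= `I_e) /\
    (forall L m, linear_subspace_of_codim d L -> X `&` L #= `I_m ->
       (m <= e)%N).

(* Degree in the sense of Heintz; a functional relation by has_degree_inj. *)
Definition has_degree (n : nat) (X : set 'rV[K]_n) (D : nat) : Prop :=
  exists (m : nat) (C : 'I_m -> set 'rV[K]_n) (e : 'I_m -> nat),
    [/\ injective C,
        forall Z, irreducible_component X Z <-> exists i, Z = C i,
        forall i, has_irreducible_degree (C i) (e i) &
        D = (\sum_(i < m) e i)%N].

Definition projection (q r : nat) (x : 'rV[K]_(q + r)) : 'rV[K]_r := rsubmx x.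

Definition projection_dominant (q r : nat) (X : set 'rV[K]_(q + r)) : Prop :=
  zariski_closure (@projection q r @` X) = setT.

Definition fiber (q r : nat) (X : set 'rV[K]_(q + r)) (a : 'rV[K]_r) :
    set 'rV[K]_(q + r) :=
  @projection q r @^-1` [set a] `&` X.

Definition grid_point (r : nat) (S : {fset k}) (a : {ffun 'I_r -> S}) :
    'rV[K]_r :=
  \row_i f (val (a i)).

Definition good_points (q r : nat) (X : set 'rV[K]_(q + r)) (S : {fset k}) :
    {set {ffun 'I_r -> S}} :=
  [set a | `[< projection_dominant X <-> fiber X (grid_point a) !=set0 >]]%SET.

Lemma has_dimension_inj n (X : set 'rV[K]_n) d d' :
  has_dimension X d -> has_dimension X d' -> d = d'.
Proof.
move=> [[Z hZ] hm] [[Z' hZ'] hm']; apply/eqP; rewrite eqn_leq.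
by rewrite (hm' _ _ hZ) (hm _ _ hZ').
Qed.

Lemma has_irreducible_degree_inj n (X : set 'rV[K]_n) e e' :
  has_irreducible_degree X e -> has_irreducible_degree X e' -> e = e'.
Proof.
move=> [d hd [[L hL cL] hm]] [d' hd' [[L' hL' cL'] hm']].
have E := has_dimension_inj hd hd'; subst d'.
by apply/eqP; rewrite eqn_leq (hm' _ _ hL cL) (hm _ _ hL' cL').
Qed.

Lemma has_degree_inj n (X : set 'rV[K]_n) D D' :
  has_degree X D -> has_degree X D' -> D = D'.
Proof.
move=> [m [C [e [iC hC he ->]]]] [m' [C' [e' [iC' hC' he' ->]]]].
have to i : exists j, C i = C' j by apply/hC'/hC; exists i.
have fro j : exists i, C' j = C i by apply/hC/hC'; exists j.
pose g i := projT1 (cid (to i)).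
have gE i : C i = C' (g i) := projT2 (cid (to i)).
pose h j := projT1 (cid (fro j)).
have hE j : C' j = C (h j) := projT2 (cid (fro j)).
have gK : cancel g h by move=> i; apply: iC; rewrite -hE -gE.
have hK : cancel h g by move=> j; apply: iC'; rewrite -gE -hE.
rewrite (reindex g) /=; last by exists h => ? _.
apply: eq_bigr => i _; apply: (has_irreducible_degree_inj (he i)).
by rewrite gE; apply: he'.
Qed.

End Varieties.

(* Main.v *)
Require Import Defs.
From HB Require Import structures.
From mathcomp Require Import all_boot all_order all_algebra.
From mathcomp Require Import finmap.
From mathcomp Require Import boolp classical_sets cardinality.
From mathcomp Require Import mpoly.
From mathcomp Require Import zify ring separable.

(* Let Z be a component of X, of dimension d and degree e.  The key fact is that
   linear forms l0, ..., ld on Z with l1, ..., ld algebraically independent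
   satisfy a nonzero polynomial relation of total degree at most e.  Take such a
   relation G of least total degree and change coordinates so that l0 is integral
   over k[z1, ..., zd] with zi = li - vi l0 and G is monic in l0 of the same
   degree.  By Gauss's lemma there is no relation of smaller degree in l0, so
   over a generic point of k^d the polynomial G has deg G distinct roots, each of
   which lifts to a point of Z on a linear subspace of codimension d that meets Z
   in finitely many points; hence deg G <= e.

   If no component dominates A^r, this yields on each component a nonzero
   polynomial of degree at most e in the coordinates of A^r, and the
   Schwartz-Zippel bound applies.  If Z dominates A^r, apply the key fact to
   A^r-coordinates completed to a transcendence basis and to
   T_tau = sum_i tau^i y_i.  Where the leading coefficient in T_tau is nonzero
   for q values of tau with the same base point, all the y_i are integral, so the
   fiber is nonempty; since S^r is finite, infinitely many tau share the same set
   of exceptional points, which has at most e |S|^(r-1) elements. *)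

Set Implicit Arguments.
Unset Strict Implicit.
Unset Printing Implicit Defensive.

Import Order.TTheory GRing.Theory Num.Theory.
Local Open Scope ring_scope.

(** * Extension of ring morphisms *)

(** The delicate point is the constant. Treating the fiber coordinates y_i one at a time would
    produce q exceptional sets and a spurious factor q in the bound. The forms T_tau avoid this: q
    of them with distinct tau already span all the y_i, and since S^r has only finitely many
    subsets, enough of them share one exceptional set, which is counted once.

    No function field or quotient ring is formed. Independence, algebraicity and transcendence
    degree are predicates modulo a prime ideal, and transcendence degree is measured by the growth
    of spans of monomials, up to denominators outside the ideal. Points of a variety come from
    extending a morphism to [K] one element at a time, where each new element satisfies an equation
    whose leading coefficient is not sent to 0; this does the work of both the Nullstellensatz and
    lying over. *)

Definition is_ideal (R : comNzRingType) (J : R -> Prop) : Prop :=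
  [/\ J 0, forall x y, J x -> J y -> J (x + y) & forall a x, J x -> J (a * x)].

Section Ideals.
Variables (R : comNzRingType) (J : R -> Prop) (idJ : is_ideal J).

Lemma ideal0 : J 0. Proof. by case: idJ. Qed.
Lemma idealD x y : J x -> J y -> J (x + y). Proof. by case: idJ => _ h _; apply: h. Qed.
Lemma idealMl a x : J x -> J (a * x). Proof. by case: idJ => _ _; apply. Qed.
Lemma idealMr a x : J x -> J (x * a). Proof. by rewrite mulrC; apply: idealMl. Qed.
Lemma idealN x : J x -> J (- x). Proof. by rewrite -mulN1r; apply: idealMl. Qed.
Lemma idealB x y : J x -> J y -> J (x - y).
Proof. by move=> Jx Jy; apply: idealD => //; apply: idealN. Qed.
Lemma ideal_sum (I : Type) (r : seq I) (P : pred I) (F : I -> R) :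
  (forall i, P i -> J (F i)) -> J (\sum_(i <- r | P i) F i).
Proof.
by move=> JF; elim/big_rec: _ => [|i x Pi Jx]; [exact: ideal0 | apply: idealD (JF i Pi) Jx].
Qed.
Lemma ideal_eqmod x y : J (x - y) -> J y -> J x.
Proof. by move=> Jxy Jy; rewrite -(subrK y x); apply: idealD. Qed.
End Ideals.

Lemma poly_drop1 (A : comNzRingType) (p : {poly A}) :
  p = 'X * drop_poly 1 p + (p`_0)%:P.
Proof.
apply/polyP => -[|i]; rewrite coefD coefXM coefC /= ?add0r ?addr0 //.
by rewrite coef_drop_poly addn1.
Qed.

Section HomExtension.
Variables (A : comNzRingType) (K : closedFieldType) (phi : {rmorphism A -> K}).
Implicit Types J : {poly A} -> Prop.

(* After saturating [J] with respect to ['X], the combination of [f] and [j] that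
   kills the constant terms may be divided by ['X]; this lowers the degree of
   [f]. *)
Lemma ideal_no_unit N J (f j : {poly A}) : is_ideal J ->
  (forall a, J a%:P -> phi a = 0) ->
  J f -> (size f <= N.+1)%N -> phi f`_N != 0 ->
  J j -> (forall i, phi j`_i.+1 = 0) -> phi j`_0 = 0.
Proof.
elim: N J f j => [|N IH] J f j idJ hJ Jf szf fN Jj j0.
  by case/eqP: fN; apply: hJ; rewrite -size1_polyC.
(* Pseudo-division by [f]. The coefficient of [j] to be eliminated has positive index, so [phi]
   kills it, and each pass only multiplies the image of [j] by the nonzero image of the leading
   coefficient of [f]. *)
have red s : forall j, J j -> (forall i, phi j`_i.+1 = 0) ->
    (size j <= s + N.+1)%N ->
    exists j', [/\ J j', forall i, phi j'`_i.+1 = 0, (size j' <= N.+1)%N &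
                   phi j'`_0 = 0 -> phi j`_0 = 0].
  elim: s => [|s IHs] {}j {}Jj {}j0 szj; first by exists j.
  pose j' := f`_N.+1 *: j - j`_(s + N.+1) *: ('X^s * f).
  have phj' i : phi j'`_i = phi f`_N.+1 * phi j`_i.
    rewrite coefB !coefZ rmorphB !rmorphM addnS j0 mul0r subr0 //.
  have [|||j2 [Jj2 j20 szj2 hj2]] := IHs j'.
  - by apply: idealB => //; rewrite -mul_polyC; do ?apply: idealMl.
  - by move=> i; rewrite phj' j0 mulr0.
  - apply/leq_sizeP => i; rewrite leq_eqVlt => /orP[/eqP <-|lti].
      by rewrite coefB !coefZ coefXnM ltnNge leq_addr /= addKn mulrC subrr.
    rewrite coefB !coefZ coefXnM.
    rewrite [j`_i](leq_sizeP _ _ szj) // mulr0 sub0r.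
    case: ltnP => lei; first by rewrite mulr0 oppr0.
    by rewrite (leq_sizeP _ _ szf) ?mulr0 ?oppr0 //; lia.
  exists j2; split=> // /hj2 /eqP; rewrite phj' mulf_eq0 (negPf fN) /=.
  by move/eqP.
have [j2 [Jj2 j20 szj2]] := red (size j) j Jj j0 (leq_addr _ _).
apply; apply/eqP/negP => /negP j2n.
pose J' P := exists m, J ('X^m * P).
have idJ' : is_ideal J'.
  split; first by exists 0%N; rewrite mulr0; apply: ideal0.
  - move=> x y [m Jx] [m' Jy]; exists (m + m')%N; rewrite mulrDr.
    apply: idealD => //; last by rewrite exprD -mulrA; apply: idealMl.
    by rewrite addnC exprD -mulrA; apply: idealMl.
  - by move=> a x [m Jx]; exists m; rewrite mulrCA; apply: idealMl.
(* Saturation adds no constants outside the kernel of [phi]: the constant term of [j2] is congruent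
   modulo [J] to a multiple of ['X], so multiplying [a] by it lowers the exponent [m] by one, and
   its image is nonzero. *)
have hJ' a : J' a%:P -> phi a = 0.
  case=> m; elim: m a => [|m IHm] a; first by rewrite mul1r; apply: hJ.
  move=> Ja; have: phi (j2`_0 * a) = 0.
    apply: IHm; rewrite polyCM.
    have -> : (j2`_0)%:P = j2 - 'X * drop_poly 1 j2.
      by rewrite {2}(poly_drop1 j2) addrC addKr.
    rewrite mulrBl mulrBr; apply: idealB => //.
      by rewrite mulrCA; apply: idealMr.
    have -> : 'X^m * ('X * drop_poly 1 j2 * a%:P) = drop_poly 1 j2 * ('X^(m.+1) * a%:P).
      by rewrite exprSr; rewrite -!mulrA; rewrite [RHS]mulrCA [in RHS](mulrCA (drop_poly _ _)).
    exact: idealMl.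
  by move/eqP; rewrite rmorphM mulf_eq0 (negPf j2n) => /eqP.
have := IH J' (j2`_0 *: drop_poly 1 f - f`_0 *: drop_poly 1 j2) j2 idJ' hJ'.
move=> h; case/eqP: (j2n); apply: h => //; last by exists 0%N; rewrite mul1r.
- exists 1%N; rewrite expr1 mulrBr -!scalerAr.
  have X1 (p : {poly A}) : 'X * drop_poly 1 p = p - (p`_0)%:P.
    by rewrite {2}(poly_drop1 p) addrK.
  rewrite !X1 !scalerBr -!mul_polyC [_ * (j2`_0)%:P]mulrC opprB addrA subrK.
  by apply: idealB => //; apply: idealMl.
- apply/leq_sizeP => i lei; rewrite coefB !coefZ !coef_drop_poly !addn1.
  rewrite [f`_i.+1](leq_sizeP _ _ szf) // [j2`_i.+1](leq_sizeP _ _ szj2) ?mulr0 ?subr0 //.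
  exact: leqW.
- rewrite coefB !coefZ !coef_drop_poly !addn1 [j2`_N.+1](leq_sizeP _ _ szj2) //.
  by rewrite mulr0 subr0 rmorphM mulf_neq0.
Qed.

(** The images of the elements of [J] need not form an ideal of [{poly K}], but pseudo-division
    inside [J] still makes every root of a nonzero image of least degree a root of all the others.
    [ideal_no_unit] keeps that image from being constant. *)
Lemma ideal_common_root N J (f : {poly A}) : is_ideal J ->
  (forall a, J a%:P -> phi a = 0) ->
  J f -> (size f <= N.+1)%N -> phi f`_N != 0 ->
  exists beta : K, forall P, J P -> (map_poly phi P).[beta] = 0.
Proof.
move=> idJ hJ Jf szf fN.
have ex : exists s, `[< exists P, [/\ J P, map_poly phi P != 0 & size (map_poly phi P) = s] >].
  exists (size (map_poly phi f)); apply/asboolP; exists f; split=> //.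
  by apply: contra_neq fN => /polyP/(_ N); rewrite coef_map coef0.
case: (ex_minnP ex) => s /asboolP[j [Jj jn0 szj]] smin.
have [beta rb] : exists beta, root (map_poly phi j) beta.
  apply/closed_rootP/negP => /eqP sz1; case/eqP: jn0.
  have j0 i : phi j`_i.+1 = 0.
    by rewrite -coef_map; apply: (leq_sizeP (map_poly phi j) 1); rewrite ?sz1.
  apply/polyP => -[|i]; rewrite coef_map coef0 /=; last exact: j0.
  exact: (ideal_no_unit idJ hJ Jf szf fN Jj).
exists beta => P; move: {2}(size (map_poly phi P)) (leqnn (size (map_poly phi P))) => t.
elim: t P => [|t IH] P.
  by rewrite leqn0 size_poly_eq0 => /eqP ->; rewrite horner0.
rewrite leq_eqVlt => /orP[/eqP szP|]; last by rewrite ltnS => /IH.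
move=> JP; have Pn0 : map_poly phi P != 0 by rewrite -size_poly_eq0 szP.
have les : (s <= t.+1)%N.
  by apply: smin; apply/asboolP; exists P.
have s0 : (0 < s)%N by rewrite -szj lt0n size_poly_eq0.
have jl : phi j`_s.-1 != 0.
  by rewrite -coef_map -szj -[_`_ _]lead_coefE lead_coef_eq0.
have : (map_poly phi (j`_s.-1 *: P - P`_t *: ('X^(t - s.-1) * j))).[beta] = 0.
  apply: IH; last first.
    by apply: idealB => //; rewrite -mul_polyC; do ?apply: idealMl.
  apply/leq_sizeP => i; rewrite leq_eqVlt => /orP[/eqP <-|lti].
    rewrite coef_map coefB !coefZ coefXnM ltnNge leq_subr /= subKn.
      by rewrite mulrC subrr rmorph0.
    by rewrite -ltnS prednK.
  rewrite coef_map coefB !coefZ coefXnM ltnNge (leq_trans (leq_subr _ _) (ltnW lti)) /=.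
  have Pz : phi P`_i = 0 by rewrite -coef_map nth_default ?szP.
  have jz : phi j`_(i - (t - s.-1)) = 0.
    by rewrite -coef_map nth_default // szj; move: lti les s0; clear; lia.
  by rewrite rmorphB !rmorphM Pz jz !mulr0 subrr.
rewrite rmorphB /= -!mul_polyC !rmorphM /= !map_polyC /= hornerD hornerN !hornerM !hornerC.
move/rootP: rb => ->; rewrite !mulr0 subr0 => /eqP; rewrite mulf_eq0 (negPf jl) /=.
by move/eqP.
Qed.

End HomExtension.

Lemma mmap_comp (R S T : comNzRingType) n (g : {rmorphism S -> T})
    (f : {rmorphism R -> S}) (h : 'I_n -> S) (p : {mpoly R[n]}) :
  g (mmap f h p) = mmap (g \o f) (g \o h) p.
Proof.
rewrite /mmap rmorph_sum; apply: eq_bigr => m _; rewrite rmorphM rmorph_prod.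
by congr (_ * _); apply: eq_bigr => i _; rewrite rmorphXn.
Qed.

Lemma eq_mmap (R S : comNzRingType) n (f g : R -> S) (h h' : 'I_n -> S)
    (p : {mpoly R[n]}) :
  f =1 g -> h =1 h' -> mmap f h p = mmap g h' p.
Proof.
move=> fg hh; rewrite /mmap; apply: eq_bigr => m _; rewrite fg.
by congr (_ * _); apply: mmap1_eq.
Qed.

Lemma mmapXU (R S : comNzRingType) n (f : {rmorphism R -> S}) (h : 'I_n -> S) i :
  mmap f h 'X_i = h i.
Proof. by rewrite mmapX mmap1U. Qed.

Lemma mmap_id (R : comNzRingType) n (p : {mpoly R[n]}) :
  mmap (@mpolyC n R) (fun i => 'X_i) p = p.
Proof.
rewrite /mmap [RHS]mpolyE; apply: eq_bigr => m _.
by rewrite mmap1_id mul_mpolyC.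
Qed.

Lemma rmorph_mpoly (R S : comNzRingType) n (g : {rmorphism {mpoly R[n]} -> S}) p :
  g p = mmap (g \o @mpolyC n R) (fun i => g 'X_i) p.
Proof. by rewrite -{1}[p]mmap_id mmap_comp. Qed.

Section HomLift.
Variables (B : comNzRingType) (K : closedFieldType) (J : B -> Prop).
Hypothesis idJ : is_ideal J.

Lemma hom_extension (A : comNzRingType) (al : {rmorphism A -> B})
    (ph : {rmorphism A -> K}) (b : B) (f : {poly A}) N :
  (forall a, J (al a) -> ph a = 0) ->
  J (map_poly al f).[b] -> (size f <= N.+1)%N -> ph f`_N != 0 ->
  exists beta, forall P, J (map_poly al P).[b] -> (map_poly ph P).[beta] = 0.
Proof.
move=> ker Jf; apply: ideal_common_root (Jf) => //; last first.
  by move=> a; rewrite map_polyC hornerC; apply: ker.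
split; first by rewrite rmorph0 horner0; apply: ideal0.
  by move=> x y; rewrite rmorphD hornerD; apply: idealD.
by move=> x y; rewrite rmorphM hornerM; apply: idealMl.
Qed.

(** [A'] is an iterated polynomial ring over [A], one variable for each [b]. Together with the
    preimage of [J] under [al'] it stands for the subring generated by [bs] modulo [J]. *)
Lemma hom_lift (bs : seq B) (A : comNzRingType) (al : {rmorphism A -> B})
    (ph : {rmorphism A -> K}) :
  (forall a, J (al a) -> ph a = 0) ->
  (forall b, b \in bs -> exists (f : {poly A}) N,
    [/\ J (map_poly al f).[b], (size f <= N.+1)%N & ph f`_N != 0]) ->
  exists (A' : comNzRingType) (iota : {rmorphism A -> A'})
      (al' : {rmorphism A' -> B}) (ph' : {rmorphism A' -> K}),
    [/\ al' \o iota =1 al, ph' \o iota =1 ph, forall a, J (al' a) -> ph' a = 0 &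
        forall b, b \in bs -> exists e, al' e = b].
Proof.
elim: bs A al ph => [|b bs IH] A al ph ker hbs; first by exists A, idfun, al, ph.
have [f [N [Jf szf fN]]] := hbs b (mem_head _ _).
have [beta hbeta] := hom_extension ker Jf szf fN.
pose al1 : {rmorphism {poly A} -> B} := horner_morph (fun x => mulrC b (al x)).
pose ph1 : {rmorphism {poly A} -> K} := horner_morph (fun x => mulrC beta (ph x)).
have al1C a : al1 a%:P = al a by rewrite /= horner_morphC.
have ph1C a : ph1 a%:P = ph a by rewrite /= horner_morphC.
have [||A' [iota [al' [ph' [ha hp hk hb]]]]] := IH {poly A} al1 ph1.
- by move=> P; apply: hbeta.
- move=> b' b'bs; have [|f' [N' [Jf' szf' fN']]] := hbs b'.
    by rewrite inE b'bs orbT.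
  exists (map_poly polyC f'), N'; split.
  + by rewrite -map_poly_comp (eq_map_poly al1C).
  + by apply/leq_sizeP => i lti; rewrite coef_map (leq_sizeP _ _ szf') // rmorph0.
  + by rewrite coef_map ph1C.
exists A', (iota \o polyC), al', ph'; split=> //.
- by move=> a /=; rewrite -[RHS]al1C -ha.
- by move=> a /=; rewrite -[RHS]ph1C -hp.
- move=> b'; rewrite inE => /orP[/eqP ->|]; last exact: hb.
  by exists (iota 'X); rewrite -[LHS]/((al' \o iota) 'X) ha /= horner_morphX.
Qed.
End HomLift.

Section LiftPoint.
Variables (k : fieldType) (K : closedFieldType) (f : {rmorphism k -> K}) (n : nat).
Variables (J : {mpoly k[n]} -> Prop) (idJ : is_ideal J).
Variables (A : comNzRingType) (cA : {rmorphism k -> A}).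
Variables (al : {rmorphism A -> {mpoly k[n]}}) (ph : {rmorphism A -> K}).
Hypothesis al_cA : al \o cA =1 @mpolyC n k.
Hypothesis ph_cA : ph \o cA =1 f.

(** [ph] extends to a ring mapping onto [{mpoly k[n]}]; the values at preimages of the variables are
    the coordinates of [x]. The variables need only be combinations of [bs] modulo the image of
    [al], because [bs] will also consist of the forms T_tau. *)
Lemma lift_point (bs : seq {mpoly k[n]}) :
  (forall a, J (al a) -> ph a = 0) ->
  (forall b, b \in bs -> exists (g : {poly A}) N,
    [/\ J (map_poly al g).[b], (size g <= N.+1)%N & ph g`_N != 0]) ->
  (forall i, exists a (lam : 'I_(size bs) -> k),
    'X_i = al a + \sum_j lam j *: bs`_j) ->
  exists x : 'I_n -> K, (forall p, J p -> mmap f x p = 0) /\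
    (forall a, mmap f x (al a) = ph a).
Proof.
move=> ker hbs hX.
have [A' [iota [al' [ph' [ha hp hk hb]]]]] := hom_lift idJ ker hbs.
have {hX} hE i : exists E, al' E = 'X_i.
  have [a [lam ->]] := hX i.
  have hb' (j : 'I_(size bs)) : exists e, al' e = bs`_j by apply/hb/mem_nth.
  exists (iota a + \sum_j iota (cA (lam j)) * projT1 (cid (hb' j))).
  rewrite rmorphD -[al' (iota a)]/((al' \o iota) a) ha; congr (_ + _).
  rewrite rmorph_sum; apply: eq_bigr => j _; rewrite rmorphM (projT2 (cid (hb' j))).
  by rewrite -[al' (iota _)]/((al' \o iota) _) ha -[al _]/((al \o cA) _) al_cA mul_mpolyC.
pose E i := projT1 (cid (hE i)).
have alE i : al' (E i) = 'X_i by rewrite /E; case: cid.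
pose s p := mmap (iota \o cA) E p.
have als p : al' (s p) = p.
  rewrite /s mmap_comp -[RHS]mmap_id; apply: eq_mmap => // c /=.
  by rewrite -[al' _]/((al' \o iota) _) ha -al_cA.
have phs p : ph' (s p) = mmap f (ph' \o E) p.
  rewrite /s mmap_comp; apply: eq_mmap => // c /=.
  by rewrite -[ph' _]/((ph' \o iota) _) hp -ph_cA.
exists (ph' \o E); split.
  by move=> p Jp; rewrite -phs; apply: hk; rewrite als.
move=> a; rewrite -phs -hp /=; apply/eqP; rewrite -subr_eq0 -rmorphB; apply/eqP/hk.
by rewrite rmorphB als -[al' (iota a)]/((al' \o iota) a) ha subrr; apply: ideal0.
Qed.
End LiftPoint.

(** * Growth and algebraic dependence *)

Lemma leq_expn2r m n e : (m <= n)%N -> (m ^ e <= n ^ e)%N.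
Proof. by case: e => // e; rewrite leq_exp2r. Qed.

Definition is_prime_ideal (R : comNzRingType) (J : R -> Prop) : Prop :=
  [/\ is_ideal J, ~ J 1 & forall x y, J (x * y) -> J x \/ J y].

Section PrimeIdeal.
Variables (R : comNzRingType) (J : R -> Prop) (prJ : is_prime_ideal J).

Lemma prime_idealX x m : ~ J x -> ~ J (x ^+ m).
Proof.
case: prJ => _ J1 pr nx; elim: m => [|m IH] //.
by rewrite exprS => /pr[].
Qed.

Lemma prime_idealM x y : ~ J x -> ~ J y -> ~ J (x * y).
Proof. by case: prJ => _ _ pr nx ny /pr[]. Qed.

End PrimeIdeal.

Section Growth.
Variables (k : fieldType) (B : comAlgType k) (I : B -> Prop).
Hypothesis prI : is_prime_ideal I.
Let idI : is_ideal I. Proof. by case: prI. Qed.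
Implicit Types (V W : seq B) (P Q : B -> Prop).

Inductive monomials V : nat -> B -> Prop :=
| monomials1 : monomials V 0 1
| monomialsM m v b of v \in V & monomials V m b : monomials V m.+1 (v * b)
| monomialsS m b of monomials V m b : monomials V m.+1 b.

Lemma monomials_le V m m' b : (m <= m')%N -> monomials V m b -> monomials V m' b.
Proof.
move=> le mb; rewrite -(subnK le); elim: (m' - m)%N => [|d IH] //.
by rewrite addSn; apply: monomialsS.
Qed.

Lemma monomials_mul V m m' b b' :
  monomials V m b -> monomials V m' b' -> monomials V (m + m') (b * b').
Proof.
move=> mb mb'; elim: mb => [|d v c vV _ IH|d c _ IH]; first by rewrite mul1r.
- by rewrite -mulrA addSn; apply: monomialsM.
- by rewrite addSn; apply: monomialsS.
Qed.

Lemma monomials_exp V v m : v \in V -> monomials V m (v ^+ m).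
Proof.
move=> vV; elim: m => [|m IH]; first exact: monomials1.
by rewrite exprS; apply: monomialsM.
Qed.

Lemma monomials_sub V W m b : {subset V <= W} -> monomials V m b -> monomials W m b.
Proof.
move=> VW; elim=> [|d v c vV _ IH|d c _ IH]; first exact: monomials1.
- exact: monomialsM (VW _ vV) IH.
- exact: monomialsS.
Qed.

Lemma monomials_cons V b m y : monomials (b :: V) m y ->
  exists j v, [/\ (j <= m)%N, monomials V m v & y = v * b ^+ j].
Proof.
elim=> [|d v c + _ [j [u [lej mu ->]]]|d c _ [j [u [lej mu ->]]]].
- by exists 0%N, 1; split; rewrite ?mulr1 //; apply: monomials1.
- rewrite inE => /orP[/eqP ->|vV].
    exists j.+1, u; split=> //; first exact: monomialsS.
    by rewrite exprS mulrCA.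
  by exists j, (v * u); rewrite mulrA; split; [apply: leqW | apply: monomialsM | ].
- by exists j, u; split; [apply: leqW | apply: monomialsS | ].
Qed.

Inductive lspan P : B -> Prop :=
| lspanI b of I b : lspan P b
| lspanD c a b of P a & lspan P b : lspan P (c *: a + b).

Lemma lspan_eqmod P b b' : lspan P b -> I (b' - b) -> lspan P b'.
Proof.
move=> sb; elim: sb b' => [b0 Ib|c a b0 Pa _ IH] b' Ibb.
  exact: lspanI (ideal_eqmod idI Ibb Ib).
rewrite -(subrK (c *: a) b') addrC; apply: lspanD => //; apply: IH.
by rewrite -addrA -opprD.
Qed.

Lemma lspan0 P : lspan P 0. Proof. exact: lspanI (ideal0 idI). Qed.

Lemma lspan_add P x y : lspan P x -> lspan P y -> lspan P (x + y).
Proof.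
move=> sx sy; elim: sx => [b Ib|c a b Pa _ IH].
  by apply: lspan_eqmod sy _; rewrite addrK.
by rewrite -addrA; apply: lspanD.
Qed.

Lemma lspan_mem P a : P a -> lspan P a.
Proof. by move=> Pa; rewrite -[a]scale1r -[_ *: _]addr0; apply: lspanD (lspan0 P). Qed.

Lemma lspan_mul P Q s x : lspan P x -> (forall a, P a -> lspan Q (s * a)) ->
  lspan Q (s * x).
Proof.
move=> sx h; elim: sx => [b Ib|c a b Pa _ IH].
  exact: lspanI (idealMl idI s Ib).
rewrite mulrDr; apply: lspan_add => //; rewrite -scalerAr.
elim: (h a Pa) => [b' Ib'|c' a' b' Qa' _ IH'].
  by apply: lspanI; rewrite -[b']mul1r scalerAl; apply: idealMl.
by rewrite scalerDr scalerA; apply: lspanD.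
Qed.

Lemma lspan_trans P Q x : lspan P x -> (forall a, P a -> lspan Q a) -> lspan Q x.
Proof. by move=> sx h; rewrite -[x]mul1r; apply: lspan_mul sx _ => a; rewrite mul1r; apply: h. Qed.

Lemma lspan_sub P Q x : (forall a, P a -> Q a) -> lspan P x -> lspan Q x.
Proof. by move=> h /lspan_trans; apply=> a /h; apply: lspan_mem. Qed.

Lemma lspan_scale P c x : lspan P x -> lspan P (c *: x).
Proof.
move=> sx; rewrite -[x]mul1r scalerAl; apply: lspan_mul sx _ => a Pa.
rewrite -scalerAl mul1r -[_ *: _]addr0; apply: lspanD => //; exact: lspan0.
Qed.

Lemma lspan_opp P x : lspan P x -> lspan P (- x).
Proof. by rewrite -scaleN1r; apply: lspan_scale. Qed.

Lemma lspan_sum P (J : Type) (r : seq J) (F : J -> B) :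
  (forall i, lspan P (F i)) -> lspan P (\sum_(i <- r) F i).
Proof.
move=> h; elim/big_rec: _ => [|i x _ sx]; [exact: lspan0 | exact: lspan_add].
Qed.

Lemma lspan_seq (e : seq B) x : lspan (fun y => y \in e) x ->
  exists c : 'I_(size e) -> k, I (x - \sum_i c i *: e`_i).
Proof.
elim=> [b Ib|c a b ae _ [d Id]].
  by exists (fun=> 0); rewrite big1 ?subr0 // => i _; rewrite scale0r.
have ia : (index a e < size e)%N by rewrite index_mem.
exists (fun i => (if i == Ordinal ia then c else 0) + d i).
under eq_bigr do rewrite scalerDl.
rewrite big_split /= (bigD1 (Ordinal ia)) //= eqxx nth_index // big1 => [|i /negPf ->].
  by rewrite addr0 opprD addrACA subrr add0r.
exact: scale0r.
Qed.

(* Up to a denominator outside [I], the monomials of degree at most [m] in [V]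
   span a space of dimension O(m ^ p): the transcendence degree of k(V) over k,
   modulo [I], is at most [p]. *)
Definition growth V p := exists C, forall m, exists s e,
  [/\ ~ I s, (size e <= C * m.+1 ^ p)%N &
      forall b, monomials V m b -> lspan (fun y => y \in e) (s * b)].

Lemma growth_nil : growth [::] 0.
Proof.
exists 1%N => m; exists 1, [:: 1]; split=> //; first by case: prI.
by move=> b mb; rewrite mul1r; apply: lspan_mem; elim: mb => //; rewrite mem_head.
Qed.

Lemma growth_cons V b p : growth V p -> growth (b :: V) p.+1.
Proof.
case=> C hC; exists C => m; have [s [e [sI sze he]]] := hC m.
exists s, [seq x * b ^+ j | x <- e, j <- iota 0 m.+1]; split=> //.
  by rewrite size_allpairs size_iota expnSr mulnA leq_mul2r sze orbT.
move=> y /monomials_cons[j [v [lej mv ->]]]; rewrite mulrA mulrC.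
apply: lspan_mul (he _ mv) _ => a ae; apply: lspan_mem.
by rewrite mulrC (allpairs_f (fun x j => x * b ^+ j)) // mem_iota.
Qed.

Definition algebraic_over V b := exists N D (c : nat -> B),
  [/\ forall j, lspan (monomials V D) (c j), ~ I (c N) &
      I (\sum_(j < N.+1) c j * b ^+ j)].

Lemma algebraic_over_sub V W b : {subset V <= W} ->
  algebraic_over V b -> algebraic_over W b.
Proof.
move=> VW [N [D [c [h1 h2 h3]]]]; exists N, D, c; split=> // j.
by apply: lspan_sub (h1 j) => a; apply: monomials_sub.
Qed.

(** Modulo [I], [c N ^+ j * b ^+ j] reduces to powers of [b] below [N] with coefficients of degree
    at most [D * j] in [V]. Degree [m] in [b :: V] thus costs a denominator [c N ^+ m], a factor [N]
    and degree [D * m + m] in [V], which changes only the constant. This is why [growth] admits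
    denominators depending on [m]. *)
Lemma growth_algebraic V b p : algebraic_over V b -> growth V p -> growth (b :: V) p.
Proof.
case=> N [D [c [hc cN Ic]]] [C hC].
pose Q m x := exists v i, [/\ monomials V m v, (i < N)%N & x = v * b ^+ i].
have QS l m x : lspan (Q m) x -> lspan (Q (D + m)%N) (c l * x).
  move=> sx; apply: lspan_mul sx _ => _ [v [i [mv ltiN ->]]].
  rewrite mulrC; apply: lspan_mul (hc l) _ => a ma; apply: lspan_mem.
  by exists (a * v), i; split=> //; [apply: monomials_mul | rewrite mulrAC [v * a]mulrC].
have N0 : (0 < N)%N.
  by case: (posnP N) Ic cN => // ->; rewrite big_ord1 mulr1.
have Qb m x : lspan (Q m) x -> lspan (Q (D + m)%N) (c N * b * x).
  move=> sx; apply: lspan_mul sx _ => _ [v [i [mv ltiN ->]]].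
  have -> : c N * b * (v * b ^+ i) = c N * (v * b ^+ i.+1).
    by rewrite exprS; rewrite -!mulrA (mulrCA b).
  move: ltiN; rewrite leq_eqVlt => /orP[/eqP ->|ltiN]; last first.
    by apply/QS/lspan_mem; exists v, i.+1.
  apply: lspan_eqmod (_ : lspan _ (- (\sum_(l < N) c l * (v * b ^+ l)))) _.
    by apply/lspan_opp/lspan_sum => l; apply/QS/lspan_mem; exists v, l.
  rewrite opprK addrC -(big_ord_recr N (fun l => c l * (v * b ^+ l))) /=.
  by under eq_bigr do rewrite mulrCA; rewrite -mulr_sumr; apply: idealMl.
have Qj j : lspan (Q (D * j)%N) (c N ^+ j * b ^+ j).
  elim: j => [|j IH]; last first.
    by rewrite mulnS -exprMn exprS exprMn; apply: Qb.
  by apply: lspan_mem; exists 1, 0%N; split; rewrite ?mulr1 ?muln0 //; apply: monomials1.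
have Qt t j : lspan (Q (D * (t + j))%N) (c N ^+ (t + j) * b ^+ j).
  elim: t => [|t IH]; first exact: Qj.
  by rewrite addSn exprS mulnS -mulrA; apply: QS.
exists (C * N * D.+1 ^ p)%N => m; have [s [e [sI sze he]]] := hC (D * m + m)%N.
exists (s * c N ^+ m), [seq x * b ^+ j | x <- e, j <- iota 0 N]; split.
- by apply: prime_idealM => //; apply: prime_idealX.
- rewrite size_allpairs size_iota.
  apply: leq_trans (leq_mul sze (leqnn N)) _.
  suff : ((D * m + m).+1 ^ p <= D.+1 ^ p * m.+1 ^ p)%N.
    by move/(leq_mul (leqnn (C * N)%N)); rewrite mulnA -mulnA mulnC; lia.
  by rewrite -expnMn leq_expn2r //; lia.
- move=> y /monomials_cons[j [v [lej mv ->]]]; rewrite -mulrA.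
  have : lspan (Q (D * m + m)%N) (v * (c N ^+ m * b ^+ j)).
    have := Qt (m - j)%N j; rewrite subnK // => q.
    apply: lspan_mul q _ => _ [w [i [mw ltiN ->]]].
    apply: lspan_mem; exists (w * v), i; split=> //.
      exact: monomials_mul.
    by rewrite mulrA [v * w]mulrC.
  rewrite mulrCA => sy; apply: lspan_mul sy _ => _ [w [i [mw ltiN ->]]].
  rewrite mulrA mulrC; apply: lspan_mul (he _ mw) _ => a ae; apply: lspan_mem.
  by rewrite mulrC (allpairs_f (fun x j => x * b ^+ j)) // mem_iota.
Qed.

Lemma growth_sub V W D p : (forall w, w \in W -> lspan (monomials V D) w) ->
  growth V p -> growth W p.
Proof.
move=> hW [C hC].
have mW m y : monomials W m y -> lspan (monomials V (D * m)) y.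
  elim=> [|d v c vW _ IH|d c _ IH].
  - by rewrite muln0; apply/lspan_mem/monomials1.
  - rewrite mulnS; apply: lspan_mul IH _ => a ma; rewrite mulrC.
    apply: lspan_mul (hW v vW) _ => a' ma'; apply: lspan_mem.
    by rewrite mulrC; apply: monomials_mul.
  - by apply: lspan_sub IH => a; apply: monomials_le; rewrite leq_mul2l leqnSn orbT.
exists (C * D.+1 ^ p)%N => m; have [s [e [sI sze he]]] := hC (D * m)%N.
exists s, e; split=> // [|b /mW sb].
  rewrite (leq_trans sze) // -mulnA leq_mul2l -expnMn leq_expn2r ?orbT //; lia.
by apply: lspan_mul sb _ => a /he.
Qed.

Lemma monomials_prod W (J : finType) (F : J -> B) (d : J -> nat) m :
  (forall i, F i \in W) -> (\sum_i d i <= m)%N ->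
  monomials W m (\prod_i F i ^+ d i).
Proof.
move=> FW /monomials_le; apply.
apply: (big_ind2 (fun x d => monomials W d x)) => [|x d1 y d2|i _].
- exact: monomials1.
- exact: monomials_mul.
- exact: monomials_exp.
Qed.

(** The products with exponents below [M] are [M ^ p.+1] in number and lie, up to the denominator
    [s], in a span of dimension O(M ^ p). For large [M] they are linearly dependent modulo [I], and
    primality removes [s]. *)
Lemma growth_dependent V p (w : 'I_p.+1 -> B) : growth V p ->
  (exists D, forall i, lspan (monomials V D) (w i)) ->
  exists2 P : {mpoly k[p.+1]}, P != 0 & I (mmap (in_alg B) w P).
Proof.
move=> gV [D hw].
have /growth_sub/(_ gV)[C hC] :
    forall y, y \in [seq w i | i <- enum 'I_p.+1] -> lspan (monomials V D) y.
  by move=> y /mapP[i _ ->].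
(* Degree [p.+1 * M] allows at most [C * (p.+2 * M) ^ p] spanning elements, fewer than [M ^ p.+1]
   once [M] exceeds [C * p.+2 ^ p]. *)
pose M := (C * p.+2 ^ p).+1.
have [s [e [sI sze he]]] := hC (p.+1 * M)%N.
pose T := {ffun 'I_p.+1 -> 'I_M}.
have cT : (size e < #|T|)%N.
  rewrite card_ffun !card_ord (leq_ltn_trans sze) //.
  apply: (@leq_ltn_trans (C * (p.+2 * M) ^ p)).
    by rewrite leq_mul2l leq_expn2r ?orbT // /M; lia.
  by rewrite expnMn mulnA expnS ltn_mul2r expn_gt0 /= /M.
pose wm (al : T) := \prod_i w i ^+ (al i).
have hwm (al : T) : exists c : 'I_(size e) -> k, I (s * wm al - \sum_i c i *: e`_i).
  apply/lspan_seq/he/monomials_prod => [i|]; first by apply: map_f; rewrite mem_enum.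
  rewrite -[X in (_ <= X * _)%N](card_ord p.+1) -sum_nat_const; apply: leq_sum => i _.
  exact/ltnW/ltn_ord.
pose c al := projT1 (cid (hwm al)).
have cP al : I (s * wm al - \sum_i c al i *: e`_i) by rewrite /c; case: cid.
pose A : 'M[k]_(#|T|, size e) := \matrix_(i, j) c (enum_val i) j.
have [u uA u0] : exists2 u : 'rV_#|T|, u *m A = 0 & u != 0.
  have /rowV0Pn[u /sub_kermxP uA u0] : kermx A != 0; last by exists u.
  by rewrite kermx_eq0 -row_leq_rank -ltnNge (leq_ltn_trans (rank_leq_col A)).
pose mn (al : T) : 'X_{1..p.+1} := [multinom (al i : nat) | i < p.+1].
have mn_inj : injective mn.
  by move=> al al' /mnmP e_al; apply/ffunP => i; apply/val_inj; have := e_al i; rewrite !mnmE.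
pose P := \sum_(al : T) u 0 (enum_rank al) *: 'X_[k, mn al].
exists P.
  apply: contra_neq u0 => P0; apply/rowP => i.
  move/(congr1 (mcoeff (mn (enum_val i)))): P0.
  rewrite mcoeff0 raddf_sum /= (bigD1 (enum_val i)) //= big1 => [|al ne_al].
    by rewrite mcoeffZ mcoeffX eqxx mulr1 addr0 enum_valK mxE.
  by rewrite mcoeffZ mcoeffX (inj_eq mn_inj) (negPf ne_al) mulr0.
have [_ _ pr] := prI; have [] // : I s \/ I (mmap (in_alg B) w P).
apply: pr; rewrite rmorph_sum mulr_sumr /=.
have -> : \sum_(al : T) s * mmap (in_alg B) w (u 0 (enum_rank al) *: 'X_[k, mn al]) =
    \sum_(al : T) u 0 (enum_rank al) *: (s * wm al - \sum_i c al i *: e`_i).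
  under [RHS]eq_bigr do rewrite scalerBr.
  rewrite sumrB [X in _ - X](_ : _ = 0) ?subr0.
    apply: eq_bigr => al _; rewrite mmapZ mmapX /= mulr_algl -scalerAr.
    by congr (_ *: (_ * _)); apply: eq_bigr => i _; rewrite mnmE.
  under eq_bigr do rewrite scaler_sumr.
  rewrite exchange_big big1 // => j _ /=.
  under eq_bigr do rewrite scalerA; rewrite -scaler_suml.
  have := congr1 (fun v : 'rV_(size e) => v 0 j) uA.
  rewrite !mxE (reindex enum_rank) /=; last by apply: onW_bij; apply: enum_rank_bij.
  by under eq_bigr do rewrite mxE enum_rankK; move=> ->; rewrite scale0r.
apply: ideal_sum => // al _; rewrite -mulr_algl.
exact: idealMl.
Qed.

End Growth.

(** * Singling out a variable; the Schwartz-Zippel bound *)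

Definition fcons (S : Type) d (t : S) (y : 'I_d -> S) (i : 'I_d.+1) : S :=
  if unlift ord0 i is Some j then y j else t.

Lemma fcons0 S d (t : S) (y : 'I_d -> S) : fcons t y ord0 = t.
Proof. by rewrite /fcons unlift_none. Qed.

Lemma fconsS S d (t : S) (y : 'I_d -> S) j : fcons t y (lift ord0 j) = y j.
Proof. by rewrite /fcons liftK. Qed.

Lemma fconsP S d (g : 'I_d.+1 -> S) : fcons (g ord0) (g \o lift ord0) =1 g.
Proof. by move=> i; rewrite /fcons; case: unliftP => [j|] ->. Qed.

Section Shear.
Variables (k : fieldType) (d : nat).
Implicit Types (v : 'I_d -> k) (P : {mpoly k[d.+1]}) (Q : {poly {mpoly k[d]}}).

(** With [v = 0] this merely regards a polynomial as one in variable 0; a general [v] is the linear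
    change of coordinates that can make it monic in that variable up to a constant. *)
Definition shear v : {mpoly k[d.+1]} -> {poly {mpoly k[d]}} :=
  mmap (polyC \o @mpolyC d k)
       (fcons 'X (fun j => ('X_j)%:P + (v j)%:MP *: 'X)).

HB.instance Definition _ v := GRing.RMorphism.on (shear v).

Lemma horner_shear v (S : comNzRingType) (g : {rmorphism k -> S}) y t P :
  (map_poly (mmap g y) (shear v P)).[t] = mmap g (fcons t (fun j => y j + g (v j) * t)) P.
Proof.
pose h := horner_morph (fun x => mulrC t (mmap g y x)).
rewrite -[LHS]/((h \o shear v) P) rmorph_mpoly; apply: eq_mmap => [c|i] /=.
  by rewrite /shear mmapC /= horner_morphC /= mmapC.
rewrite /shear mmapXU /fcons; case: unliftP => [j|] _; rewrite ?horner_morphX //.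
by rewrite rmorphD -mul_polyC rmorphM /= !horner_morphC /= mmapXU horner_morphX mmapC.
Qed.

Definition unshear v : {poly {mpoly k[d]}} -> {mpoly k[d.+1]} :=
  horner_morph (fun x => mulrC 'X_ord0
    (mmap (@mpolyC d.+1 k) (fun j => 'X_(lift ord0 j) - v j *: 'X_ord0) x)).

HB.instance Definition _ v := GRing.RMorphism.on (unshear v).

Lemma mmap_unshear v (S : comNzRingType) (g : {rmorphism k -> S}) w Q :
  mmap g w (unshear v Q) =
  (map_poly (mmap g (fun j => w (lift ord0 j) - g (v j) * w ord0)) Q).[w ord0].
Proof.
rewrite /unshear /horner_morph -horner_map /= mmapXU -map_poly_comp.
congr (_.[_]); apply: eq_map_poly => p; rewrite /= mmap_comp.
apply: eq_mmap => [c|j] /=; first by rewrite mmapC.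
by rewrite rmorphB /= mmapZ !mmapXU.
Qed.

Lemma unshearK v : cancel (unshear v) (shear v).
Proof.
move=> Q; rewrite /unshear /horner_morph -horner_map -map_poly_comp /=.
rewrite /shear mmapXU fcons0 -[RHS](comp_polyXr Q) /comp_poly; congr (_.[_]).
apply: eq_map_poly => p /=; rewrite mmap_comp [RHS](rmorph_mpoly polyC).
apply: eq_mmap => [c|j] /=; first by rewrite mmapC.
by rewrite rmorphB /= mmapZ !mmapXU fcons0 fconsS /= mul_polyC addrK.
Qed.

Lemma shearK v : cancel (shear v) (unshear v).
Proof.
move=> P; rewrite -[LHS]/((unshear v \o shear v) P) rmorph_mpoly -[RHS]mmap_id.
have uC (p : {mpoly k[d]}) : unshear v p%:P =
    mmap (@mpolyC d.+1 k) (fun j => 'X_(lift ord0 j) - v j *: 'X_ord0) p.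
  by rewrite /unshear horner_morphC.
apply: eq_mmap => [c|i] /=; first by rewrite /shear mmapC /= uC mmapC.
rewrite /shear mmapXU /fcons; case: unliftP => [j|] ->; last by rewrite /unshear horner_morphX.
rewrite rmorphD -mul_polyC rmorphM /= !uC mmapXU mmapC /unshear horner_morphX.
by rewrite mul_mpolyC subrK.
Qed.

Lemma shear_eq0 v P : (shear v P == 0) = (P == 0).
Proof. by rewrite -(inj_eq (can_inj (shearK v))) rmorph0. Qed.

(** ['X] counts as one more variable, and [msize] is the degree plus one. Zero coefficients are
    excluded because their index is unbounded. *)
Definition total_degree_le D Q :=
  forall i, Q`_i != 0 -> (msize Q`_i + i <= D.+1)%N.

Lemma total_degree_leW D D' Q : (D <= D')%N ->
  total_degree_le D Q -> total_degree_le D' Q.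
Proof. by move=> le h i /h /leq_trans; apply. Qed.

Lemma total_degree_leD D Q Q' : total_degree_le D Q -> total_degree_le D Q' ->
  total_degree_le D (Q + Q').
Proof.
move=> h h' i; rewrite coefD.
have [->|Qi] := eqVneq Q`_i 0; first by rewrite add0r; apply: h'.
have [->|Q'i] := eqVneq Q'`_i 0; first by rewrite addr0 => _; apply: h.
move=> _; apply: leq_trans (leq_add (msizeD_le _ _) (leqnn i)) _.
by rewrite addn_maxl geq_max h // h'.
Qed.

Lemma total_degree_leM D D' Q Q' : total_degree_le D Q -> total_degree_le D' Q' ->
  total_degree_le (D + D') (Q * Q').
Proof.
move=> h h' i; rewrite coefM.
set F := fun j : 'I_i.+1 => Q`_j * Q'`_(i - j) => s0.
have [|j0 j0max] := @bigop.eq_bigmax _ (fun j => msize (F j)); first by rewrite card_ord.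
have les : (msize (\sum_j F j) <= msize (F j0))%N by rewrite -j0max msize_sum.
have F0 : F j0 != 0.
  by rewrite -msize_poly_eq0 -lt0n (leq_trans _ les) // lt0n msize_poly_eq0.
have [Q0 Q'0] : Q`_j0 != 0 /\ Q'`_(i - j0) != 0.
  by move: F0; rewrite mulf_eq0 negb_or => /andP.
have hQ := h _ Q0; have hQ' := h' _ Q'0; have lej : (j0 <= i)%N by rewrite -ltnS.
rewrite (msizeM Q0 Q'0) in les; rewrite -msize_poly_eq0 -lt0n in Q0.
apply: leq_trans (leq_add les (leqnn i)) _; move: hQ hQ' lej Q0.
move: (nat_of_ord j0) (msize Q`_j0) => j a; move: (msize _) => b.
lia.
Qed.

Lemma total_degree_le_sum D (T : eqType) (r : seq T) (F : T -> {poly {mpoly k[d]}}) :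
  (forall x, x \in r -> total_degree_le D (F x)) ->
  total_degree_le D (\sum_(x <- r) F x).
Proof.
move=> h; rewrite big_seq; elim/big_rec: _ => [i|x Q xr hQ]; first by rewrite coef0 eqxx.
exact: total_degree_leD (h x xr) hQ.
Qed.

Lemma total_degree_shearX v m : total_degree_le (mdeg m) (shear v 'X_[k, m]).
Proof.
rewrite /shear mmapX /mmap1 mdegE.
apply: (big_ind2 (fun Q D => total_degree_le D Q)) => [[|i]|Q D Q' D'|i _].
- by rewrite coef1 msize1.
- by rewrite coef1 eqxx.
- exact: total_degree_leM.
elim: (m i) => [|e IH]; first by case=> [|j]; rewrite expr0 coef1 ?msize1 ?eqxx.
rewrite exprS -add1n; apply: total_degree_leM => //.
rewrite /fcons; case: unliftP => [j|] _ [|[|n]];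
  rewrite ?coefD ?coefC ?coefZ ?coefX /= ?mulr0 ?mulr1 ?addr0 ?add0r ?eqxx //.
- by rewrite msizeX mdeg1.
- by rewrite msizeC; case: (v j != 0).
- by rewrite msize1.
Qed.

Lemma shearE v P : shear v P = \sum_(m <- msupp P) (P@_m)%:MP%:P * shear v 'X_[k, m].
Proof.
rewrite {1}[P]mpolyE rmorph_sum; apply: eq_bigr => m _.
by rewrite -mul_mpolyC rmorphM /= {1}/shear mmapC.
Qed.

Lemma total_degree_shear v P : total_degree_le (msize P).-1 (shear v P).
Proof.
rewrite shearE; apply: total_degree_le_sum => m mP.
rewrite -[(msize P).-1]add0n; apply: total_degree_leM.
  move=> [|i]; rewrite coefC ?eqxx //= msizeC => _; by case: (_ != 0).
apply: (@total_degree_leW (mdeg m)); last exact: total_degree_shearX.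
  by have := msize_mdeg_lt mP; lia.
Qed.

Lemma size_shear v P : (size (shear v P) <= msize P)%N.
Proof.
have [->|P0] := eqVneq P 0; first by rewrite rmorph0 size_poly0.
apply/leq_sizeP => i lei; apply/eqP/negP => /negP /[dup] /total_degree_shear.
rewrite -msize_poly_eq0; move: P0; rewrite -msize_poly_eq0; lia.
Qed.

Lemma msize_coef_shear v P i : (msize (shear v P)`_i <= msize P)%N.
Proof.
have [->|nz] := eqVneq (shear v P)`_i 0; first by rewrite mmeasure0.
have P0 : P != 0 by apply: contra_neq nz => ->; rewrite rmorph0 coef0.
by have := total_degree_shear nz; rewrite -mpolySpred //; apply: leq_trans; apply: leq_addr.
Qed.

(** The leading form of [P] with variable 0 set to 1; its value at [v] is the coefficient in
    [shear v P] of the power of ['X] whose exponent is the degree of [P]. *)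
Definition dehomogenized_top P : {mpoly k[d]} :=
  \sum_(m <- msupp P | (mdeg m).+1 == msize P)
    P@_m *: 'X_[k, [multinom m (lift ord0 j) | j < d]].

(** Among monomials of top degree the exponent of variable 0 is determined by the others, so no two
    terms merge. *)
Lemma dehomogenized_top_neq0 P : P != 0 -> dehomogenized_top P != 0.
Proof.
move=> P0; pose r (m : 'X_{1..d.+1}) : 'X_{1..d} := [multinom m (lift ord0 j) | j < d].
pose m0 := mlead P; have m0P : m0 \in msupp P by apply: mlead_supp.
apply/eqP => /(congr1 (mcoeff (r m0))); rewrite mcoeff0 raddf_sum /=.
rewrite -big_filter (bigD1_seq m0) ?filter_uniq ?msupp_uniq //=; last first.
  by rewrite mem_filter mlead_deg // eqxx.
rewrite mcoeffZ mcoeffX eqxx mulr1 big1_seq => [/eqP|m].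
  by rewrite addr0 mleadc_eq0 (negPf P0).
rewrite mem_filter => /and3P[ne /eqP sm _].
rewrite mcoeffZ mcoeffX [_ == _](_ : _ = false) ?mulr0 //.
apply/negP => /eqP /mnmP rm; case/negP: ne; apply/eqP/mnmP.
have rm' j : m (lift ord0 j) = m0 (lift ord0 j) by have := rm j; rewrite !mnmE.
move=> i; case: (unliftP ord0 i) => [j ->|->] //.
have : mdeg m = mdeg m0 by have := mlead_deg P0; rewrite -sm => -[->].
by rewrite !mdegE !big_ord_recl (eq_bigr (fun j => m0 (lift ord0 j))) // => /addIn.
Qed.

(** The coefficient in question has degree 0 in the remaining variables, so it can be read off after
    setting these to 0. *)
Lemma mevalE_top v P : (dehomogenized_top P).@[v] != 0 ->
  exists c, [/\ c != 0, size (shear v P) = msize P & lead_coef (shear v P) = c%:MP].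
Proof.
move=> tv; have P0 : P != 0.
  by apply: contra_neq tv => ->; rewrite /dehomogenized_top msupp0 big_nil meval0.
have sP : msize P = (msize P).-1.+1 by apply: mpolySpred.
set D := (msize P).-1 in sP.
have cD : (shear v P)`_D = ((dehomogenized_top P).@[v])%:MP.
  have top0 : (shear v P)`_D != 0 ->  (msize (shear v P)`_D <= 1)%N.
    by move/total_degree_shear; rewrite -/D -add1n leq_add2r.
  have -> : (shear v P)`_D = (((shear v P)`_D)@_0%MM)%:MP.
    apply: msize1_polyC; have [->|] := eqVneq (shear v P)`_D 0; first by rewrite mmeasure0.
    exact: top0.
  congr (_%:MP); rewrite -[LHS](coef_map (mcoeff 0%MM)).
  have -> : map_poly (mcoeff 0%MM) (shear v P) =
      mmap polyC (fcons 'X (fun j => 0 + (v j)%:P * 'X)) P.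
    rewrite -(horner_shear v polyC (fun=> 0)) -[LHS]comp_polyXr /comp_poly.
    rewrite -map_poly_comp; congr (_.[_]); apply: eq_map_poly => p.
    rewrite [LHS](rmorph_mpoly (polyC \o mcoeff 0%MM)); apply: eq_mmap => [c|j] /=.
      by rewrite mcoeffC eqxx mulr1.
    by rewrite mcoeffX mnm1_eq0.
  rewrite /mmap coef_sum /dehomogenized_top raddf_sum /= [RHS]big_mkcond /=.
  apply: eq_bigr => m _; rewrite coefCM /mmap1 big_ord_recl fcons0.
  under eq_bigr do rewrite fconsS add0r exprMn -rmorphXn.
  rewrite big_split /= prodrXr -rmorph_prod mulrCA -exprD -[(_ + \sum_i _)%N]big_ord_recl -mdegE.
  rewrite coefCM coefXn sP eqSS [D == _]eq_sym; case: eqP => _; last by rewrite !mulr0.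
  by rewrite mevalZ mevalX mulr1; congr (_ * _); apply: eq_bigr => j _; rewrite mnmE.
have sz : size (shear v P) = msize P.
  apply/eqP; rewrite eqn_leq size_shear sP ltnNge; apply/negP => /leq_sizeP/(_ _ (leqnn D)).
  by rewrite cD => /eqP; rewrite mpolyC_eq0 (negPf tv).
by exists (dehomogenized_top P).@[v]; rewrite lead_coefE sz; split.
Qed.
End Shear.

Lemma card_roots_le (k : fieldType) (T : finType) (io : T -> k) (p : {poly k}) :
  injective io -> p != 0 -> (#|[pred t | root p (io t)]| < size p)%N.
Proof.
move=> io_inj p0; rewrite cardE -(size_map io); apply: max_poly_roots => //.
  by apply/allP => _ /mapP[t + ->]; rewrite mem_enum.
by rewrite map_inj_uniq // enum_uniq.
Qed.

(** Induction through the leading coefficient [c] in variable 0. Where [c] vanishes all of [T] is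
    conceded, but the degree of [c] is smaller by the degree in variable 0; elsewhere a nonzero
    polynomial in one variable has few roots. Multiplying by [#|T|] keeps the bound in the natural
    numbers. *)
Lemma schwartz_zippel (k : fieldType) (T : finType) (io : T -> k) r
    (P : {mpoly k[r]}) : injective io -> P != 0 ->
  (#|[set a : {ffun 'I_r -> T} | P.@[io \o a] == 0%R]| * #|T|
     <= (msize P).-1 * #|T| ^ r)%N.
Proof.
move=> io_inj; elim: r P => [|r IH] P P0.
  rewrite (_ : [set _ | _] = finset.set0) ?cards0 ?mul0n //.
  apply/finset.setP => a; rewrite !inE; apply/negP => /eqP; rewrite (nvar0_mpolyC P) mevalC => P00.
  by case/eqP: P0; rewrite (nvar0_mpolyC P) P00.
pose Q := shear (fun=> 0) P; have Q0 : Q != 0 by rewrite shear_eq0.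
pose c := lead_coef Q; have c0 : c != 0 by rewrite lead_coef_eq0.
pose cons (x : T * {ffun 'I_r -> T}) := [ffun i => fcons x.1 x.2 i].
pose uncons (a : {ffun 'I_r.+1 -> T}) := (a ord0, [ffun j => a (lift ord0 j)]).
have consK : cancel cons uncons.
  move=> [t a]; rewrite /uncons /cons ffunE fcons0; congr (_, _).
  by apply/ffunP => j; rewrite !ffunE fconsS.
have unconsK : cancel uncons cons.
  move=> a; apply/ffunP => i; rewrite ffunE -[RHS]fconsP /= /fcons.
  by case: unliftP => [j|] _ //=; rewrite ffunE.
pose Qa (a : {ffun 'I_r -> T}) := map_poly (meval (io \o a)) Q.
have evP t a : P.@[io \o cons (t, a)] = (Qa a).[io t].
  rewrite /Qa (horner_shear _ idfun); apply: eq_mmap => // i.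
  by rewrite /= ffunE /fcons; case: unlift => //= j; rewrite mul0r addr0.
rewrite -sum1_card (reindex cons) /=; last by apply: onW_bij; exists uncons.
under eq_bigl do rewrite inE.
rewrite (eq_bigl (fun x => true && ((Qa x.2).[io x.1] == 0))) /=; last first.
  by case=> t a; rewrite -evP.
rewrite -(pair_big_dep xpredT (fun t a => (Qa a).[io t] == 0%R) (fun _ _ => 1%N)) /=.
rewrite (exchange_big_dep xpredT) //=.
have : (\sum_(a : {ffun 'I_r -> T}) \sum_(t | (Qa a).[io t] == 0%R) 1 <=
    \sum_(a : {ffun 'I_r -> T}) ((c.@[io \o a] == 0%R) * #|T| + (size Q).-1))%N.
  apply: leq_sum => a _; rewrite sum1_card; case: eqP => [_|/eqP ca].
    by rewrite mul1n (leq_trans (max_card _)) ?leq_addr.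
  rewrite mul0n add0n; have Qa0 : Qa a != 0.
    apply: contra_neq ca => /polyP/(_ (size Q).-1); rewrite coef_map coef0 /=.
    by rewrite -lead_coefE.
  rewrite -ltnS prednK ?lt0n ?size_poly_eq0 //.
  by apply: leq_trans (card_roots_le io_inj Qa0) _; rewrite /Qa size_poly.
rewrite big_split /= -big_distrl /= sum_nat_const card_ffun card_ord.
move=> le1; have := IH c c0.
have -> : #|[set a : {ffun 'I_r -> T} | c.@[io \o a] == 0%R]| =
    (\sum_(a : {ffun 'I_r -> T}) (c.@[io \o a] == 0%R))%N.
  by rewrite -sum1_card big_mkcond /=; apply: eq_bigr => a _; rewrite inE; case: (_ == _).
move=> hc; have Qc : Q`_(size Q).-1 != 0 by rewrite -lead_coefE.
have := total_degree_shear Qc; rewrite -lead_coefE -/c expnS.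
move: le1 hc; move: (\sum_(a : _) _)%N => z1.
move: (\sum_(a : _) _)%N => z; move: (#|T| ^ r)%N => tr.
have := mpolySpred mdeg c0; have := mpolySpred mdeg P0.
move: (msize c) (msize P) (size Q).-1 => mc mP s -> -> /= h1 h2 h3.
apply: leq_trans (leq_mul h1 (leqnn _)) _; rewrite mulnDl.
have : (z * #|T| * #|T| <= mc.-1 * tr * #|T|)%N by rewrite leq_mul2r h2 orbT.
move: (#|T|) => t h4.
have : ((mc.-1 + s) * (tr * t) <= mP.-1 * (tr * t))%N by rewrite leq_mul2r; lia.
nia.
Qed.

Lemma natr_inj_char0 (k : fieldType) : [pchar k] =i pred0 ->
  injective (fun n : nat => n%:R : k).
Proof.
move/pcharf0P => h m n; wlog le_mn : m n / (m <= n)%N.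
  by case: (leqP m n) => [|/ltnW] le w e; [apply: w | apply/esym/w].
move=> e; have : (n - m)%:R == 0 :> k by rewrite natrB // e subrr.
by rewrite h; lia.
Qed.

(** On a grid of side [msize P], one more than the degree, the bound leaves a nonroot;
    characteristic 0 supplies the grid. *)
Lemma mpoly_nonroot (k : fieldType) (char0 : [pchar k] =i pred0) r (P : {mpoly k[r]}) :
  P != 0 -> exists v : 'I_r -> k, P.@[v] != 0.
Proof.
move=> P0; pose io (i : 'I_(msize P)) : k := (val i)%:R.
have io_inj : injective io by move=> i j /(natr_inj_char0 char0)/val_inj.
have := schwartz_zippel io_inj P0; rewrite card_ord.
case: (pickP (fun a : {ffun 'I_r -> 'I_(msize P)} => P.@[io \o a] != 0)) => [a Pa _|all0].
  by exists (io \o a).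
rewrite (_ : [set _ | _] = [set: _])%SET; last first.
  by apply/finset.setP => a; rewrite !inE; have /negbFE := all0 a.
rewrite cardsT card_ffun !card_ord.
have := mpolySpred mdeg P0; move: (msize P) => s -> /=.
by rewrite -expnSr expnS leq_mul2r expn_eq0 /= ltnn.
Qed.

(** * Algebraic independence and transcendence degree modulo a prime ideal *)

Section AlgIndep.
Variables (k : fieldType) (B : comAlgType k) (I : B -> Prop).
Hypothesis prI : is_prime_ideal I.
Let idI : is_ideal I. Proof. by case: prI. Qed.
Implicit Types (V W ws : seq B).

Definition evs ws : {mpoly k[size ws]} -> B :=
  mmap (in_alg B) (fun i => ws`_i).

Arguments evs : clear implicits.
HB.instance Definition _ ws := GRing.RMorphism.on (evs ws).

Definition alg_indep ws := forall P : {mpoly k[size ws]}, I (evs ws P) -> P = 0.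

Lemma alg_indep_nil : alg_indep [::].
Proof.
move=> P; rewrite (nvar0_mpolyC P) /evs mmapC /= => IP; apply/eqP; rewrite mpolyC_eq0.
apply/negP => /negP P0; case: prI => _ + _; apply.
have -> : 1 = (P@_0%MM)^-1%:A * (P@_0%MM)%:A :> B.
  by rewrite -scalerAl mul1r scalerA mulVf // scale1r.
exact: idealMl.
Qed.

Lemma evs_cons b ws (P : {mpoly k[(size ws).+1]}) :
  evs (b :: ws) P = (map_poly (evs ws) (shear (fun=> 0) P)).[b].
Proof.
rewrite (horner_shear _ (in_alg B)); apply: eq_mmap => // i.
rewrite /fcons; case: unliftP => [j|] -> //=.
by rewrite scale0r mul0r addr0.
Qed.

Lemma alg_indep_consP b ws : alg_indep ws ->
  alg_indep (b :: ws) \/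
  exists2 Q : {poly {mpoly k[size ws]}}, Q != 0 & I (map_poly (evs ws) Q).[b].
Proof.
move=> iw; have [ib|nib] := pselect (alg_indep (b :: ws)); first by left.
right; move/existsPNP: nib => [P IP P0]; exists (shear (fun=> 0) P).
  by rewrite shear_eq0; apply/eqP.
by rewrite -evs_cons.
Qed.

Lemma lspan_evs ws p : lspan I (monomials ws (msize p)) (evs ws p).
Proof.
rewrite /evs /mmap big_seq; elim/big_rec: _ => [|m x mp sx]; first exact: lspan0.
rewrite /= mulr_algl; apply: lspanD => //.
apply: monomials_prod => [i|]; first exact: mem_nth.
by rewrite -mdegE ltnW // msize_mdeg_lt.
Qed.

Lemma dependent_algebraic_over b ws (Q : {poly {mpoly k[size ws]}}) : alg_indep ws ->
  Q != 0 -> I (map_poly (evs ws) Q).[b] -> algebraic_over I ws b.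
Proof.
move=> iw Q0 IQ; exists (size Q).-1, (\max_(i < size Q) msize Q`_i), (fun j => evs ws Q`_j).
split.
- move=> j; have [ltj|lej] := ltnP j (size Q); last first.
    by rewrite nth_default // rmorph0; apply: lspan0.
  apply: (lspan_sub prI _ (lspan_evs Q`_j)) => a; apply: monomials_le.
  exact: (leq_bigmax (F := fun i : 'I_(size Q) => msize Q`_i) (Ordinal ltj)).
- by move/iw/eqP; rewrite -lead_coefE lead_coef_eq0 (negPf Q0).
move: IQ; rewrite (@horner_coef_wide _ (size Q)) ?size_poly //.
rewrite prednK ?lt0n ?size_poly_eq0 //.
by under eq_bigr do rewrite coef_map.
Qed.

Lemma growth_size ws : growth I ws (size ws).
Proof. by elim: ws => [|b ws IH]; [exact: growth_nil | exact: growth_cons]. Qed.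

(** Greedy choice: an element of [zs] is kept if independence survives; otherwise it is algebraic
    over those kept and leaves the growth exponent unchanged. *)
Lemma alg_indep_extend zs ws : alg_indep ws -> exists ys,
  [/\ subseq ys zs, alg_indep (ys ++ ws) & growth I (zs ++ ws) (size (ys ++ ws))].
Proof.
move=> iw; elim: zs => [|z zs [ys [sub iy gy]]].
  by exists [::]; split=> //; apply: growth_size.
have [iz|[Q Q0 IQ]] := alg_indep_consP z iy.
  by exists (z :: ys); split=> //=; rewrite ?eqxx //; apply: growth_cons.
exists ys; split=> //; first exact: subseq_trans (subseq_cons _ _).
apply: growth_algebraic => //.
apply: (algebraic_over_sub prI _ (dependent_algebraic_over iy Q0 IQ)) => y.
rewrite !mem_cat => /orP[/(mem_subseq sub) ->//|->]; by rewrite orbT.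
Qed.

Lemma growth_le V p q : (p <= q)%N -> growth I V p -> growth I V q.
Proof.
move=> le [C hC]; exists C => m; have [s [e [sI sze he]]] := hC m; exists s, e; split=> //.
by rewrite (leq_trans sze) // leq_mul2l leq_pexp2l ?orbT.
Qed.

(** This takes the place of the exchange lemma for transcendence bases: more than [p] elements would
    satisfy a relation by [growth_dependent]. *)
Lemma alg_indep_growth V p ws : growth I V p ->
  (exists D, forall w, w \in ws -> lspan I (monomials V D) w) ->
  alg_indep ws -> (size ws <= p)%N.
Proof.
move=> gV [D hw] iw; rewrite leqNgt; apply/negP => lt_p.
case: ws lt_p hw iw => // b ws; rewrite /= ltnS => le_p hw iw.
have [|P P0 IP] := growth_dependent prI (w := fun i => (b :: ws)`_i) (growth_le le_p gV).
  by exists D => i; apply/hw/mem_nth.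
by move/eqP: P0; apply; apply: iw.
Qed.

Variable xs : seq B.
Hypothesis gen_xs : forall b, exists D, lspan I (monomials xs D) b.

Lemma gen_xs_uniform ws : exists D, forall w, w \in ws -> lspan I (monomials xs D) w.
Proof.
elim: ws => [|w ws [D hD]]; first by exists 0%N.
have [D' hD'] := gen_xs w; exists (D + D')%N => y; rewrite inE => /orP[/eqP ->|/hD].
  by apply: (lspan_sub prI _ hD') => a; apply: monomials_le; apply: leq_addl.
move=> hy; apply: (lspan_sub prI _ hy) => a; apply: monomials_le; apply: leq_addr.
Qed.

(** Growth gives the upper bound, an independent family the lower one; [trdeg_inj] shows that
    together they determine [d]. *)
Definition trdeg d := growth I xs d /\ exists2 ws, alg_indep ws & size ws = d.

Lemma trdeg_alg_indep_le d ws : trdeg d -> alg_indep ws -> (size ws <= d)%N.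
Proof. by case=> g _; apply: alg_indep_growth g (gen_xs_uniform ws). Qed.

Lemma growth_drop V W p : growth I (V ++ W) p -> growth I V p.
Proof.
apply: (@growth_sub _ _ _ prI _ _ 1) => w wV; apply: lspan_mem => //.
by rewrite -[w]mulr1; apply: monomialsM; [rewrite mem_cat wV | apply: monomials1].
Qed.

Lemma trdeg_ex : exists d, trdeg d.
Proof.
have [ys [_ iy gy]] := alg_indep_extend xs alg_indep_nil.
exists (size (ys ++ [::])); split; first exact: growth_drop gy.
by exists (ys ++ [::]).
Qed.

Lemma trdeg_basis d ws : trdeg d -> alg_indep ws ->
  exists ys, [/\ subseq ys xs, alg_indep (ys ++ ws) & size (ys ++ ws) = d].
Proof.
move=> td iw; have [ys [sub iy gy]] := alg_indep_extend xs iw.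
exists ys; split=> //; apply/eqP; rewrite eqn_leq (trdeg_alg_indep_le td iy) /=.
case: td => _ [w iw' <-]; apply: alg_indep_growth (growth_drop gy) (gen_xs_uniform w) iw'.
Qed.

Lemma trdeg_dependent d ws b : trdeg d -> alg_indep ws -> size ws = d ->
  exists2 Q : {poly {mpoly k[size ws]}}, Q != 0 & I (map_poly (evs ws) Q).[b].
Proof.
move=> td iw sw; have [ib|//] := alg_indep_consP b iw.
by exfalso; have := trdeg_alg_indep_le td ib; rewrite /= sw ltnn.
Qed.

Lemma trdeg_inj d d' : trdeg d -> trdeg d' -> d = d'.
Proof.
suff le e e' : trdeg e -> trdeg e' -> (e <= e')%N.
  by move=> td td'; apply/eqP; rewrite eqn_leq !le.
by case=> _ [w iw <-] td; apply: trdeg_alg_indep_le td iw.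
Qed.
End AlgIndep.

Arguments evs {k B} ws P.

(** * Gauss's lemma *)

Lemma fractionP (R : idomainType) (e : {fraction R}) :
  exists p q : R, q != 0 /\ e = (@FracField.tofrac R p) / (@FracField.tofrac R q).
Proof.
elim/quotW: e => x; exists (frac x).1, (frac x).2; split; first exact: denom_ratioP.
apply: (canRL (mulfK _)); first by rewrite tofrac_eq0 denom_ratioP.
unlock FracField.tofrac; rewrite -[LHS]FracField.pi_mul; apply/eqmodP => /=.
have d0 := denom_ratioP x.
rewrite /FracField.equivf /FracField.mulf /= !numden_Ratio ?oner_neq0 ?mulr1 //.
by rewrite mulrC.
Qed.

(* Polynomial rings are completely integrally closed: comparing leading
   monomials of [h * p ^+ i] for all [i] shows that the leading monomial of [q]
   divides that of [p], so that a division step can be performed. *)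
Lemma mpoly_almost_integral (k : fieldType) n (h p q : {mpoly k[n]}) :
  h != 0 -> q != 0 -> (forall i, exists c, h * p ^+ i = c * q ^+ i) ->
  exists c, p = c * q.
Proof.
move=> h0 q0; move: {2}(mlead p) (erefl (mlead p)) => m.
elim/(well_founded_ind (@ltom_wf n)): m p => m IH p mp hp.
have [->|p0] := eqVneq p 0; first by exists 0; rewrite mul0r.
have le_qp : (mlead q <= mlead p)%MM.
  (* With exponent [(mlead h j).+1], a deficit of [mlead p] against [mlead q] at [j] grows to at
     least [mlead h j + 1], more than [h] can make up for. *)
  apply/mnm_lepP => j; have [c hc] := hp (mlead h j).+1.
  have c0 : c != 0.
    have : h * p ^+ (mlead h j).+1 != 0 by rewrite mulf_neq0 // expf_neq0.
    by rewrite hc mulf_eq0 negb_or => /andP[].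
  have := congr1 (fun x => mlead x j) hc.
  rewrite (mleadM h0 (expf_neq0 _ p0)) (mleadM c0 (expf_neq0 _ q0)) !mleadX //.
  rewrite !mnmDE !mulmnE; move: (mlead h j) (mlead c j) (mlead p j) (mlead q j) => H C P Q.
  rewrite [(Q <= P)%N]leqNgt => e; apply/negP => lt_PQ.
  have := leq_mul lt_PQ (leqnn H.+1); lia.
pose t := (mleadc p / mleadc q) *: 'X_[k, mlead p - mlead q].
have lq0 : mleadc q != 0 by rewrite mleadc_eq0.
have lp0 : mleadc p != 0 by rewrite mleadc_eq0.
have lt0 : mleadc p / mleadc q != 0 by rewrite mulf_neq0 ?invr_eq0.
have t0 : t != 0.
  by rewrite -mleadc_eq0 /t mleadZ // mleadXm mcoeffZ mcoeffX eqxx mulr1.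
have mt : mlead t = (mlead p - mlead q)%MM by rewrite /t mleadZ // mleadXm.
have mtq : mlead (t * q) = mlead p by rewrite mleadM // mt submK.
have ctq : (t * q)@_(mlead p) = mleadc p.
  by rewrite -{1}mtq mleadM // mleadcM /t mleadZ // mleadXm mcoeffZ mcoeffX eqxx mulr1 divfK.
have [c hc] : exists c, p - t * q = c * q; last first.
  by exists (c + t); rewrite mulrDl -hc subrK.
have [->|d0] := eqVneq (p - t * q) 0; first by exists 0; rewrite mul0r.
apply: (IH (mlead (p - t * q))) => //.
  rewrite -mp lt_neqAle; apply/andP; split.
    apply: contra_neq d0 => e; apply/eqP; rewrite -mleadc_eq0 e.
    by rewrite mcoeffB ctq subrr.
  by apply: le_trans (mleadB_le _ _) _; rewrite mtq joinxx.
move=> i.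
(* In the binomial expansion of [(p - t * q) ^+ i] each term times [h] is divisible by [q ^+ i], so
   the hypothesis passes to the remainder. *)
have hc j : exists c, h * (p ^+ (i - j) * (t * q) ^+ j) = c * q ^+ (i - j + j).
  by have [c hc] := hp (i - j)%N; exists (c * t ^+ j); rewrite exprD exprMn mulrA hc; ring.
pose c j := projT1 (cid (hc j)).
exists (\sum_(j < i.+1) (-1) ^+ j * c j *+ 'C(i, j)).
rewrite exprBn mulr_sumr mulr_suml; apply: eq_bigr => j _.
rewrite mulrnAr mulrnAl; congr (_ *+ _).
have e : h * (p ^+ (i - j) * (t * q) ^+ j) = c j * q ^+ i.
  by have := projT2 (cid (hc j)); rewrite -/(c j) => ->; rewrite subnK // -ltnS.
by rewrite -[RHS]mulrA -e; ring.
Qed.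

(** The inverse Vandermonde matrix recovers the coefficients of a polynomial from its values. It
    serves for characteristic polynomials and for expressing the y_i through the T_tau. *)
Lemma lagrange_coef (k : fieldType) n (a : 'I_n -> k) : injective a ->
  exists lam : 'I_n -> 'I_n -> k, forall j l : 'I_n, \sum_i lam j i * a i ^+ l = (l == j)%:R.
Proof.
move=> a_inj; pose V := Vandermonde n (\row_i a i).
have uV : V \in unitmx.
  rewrite unitmxE det_Vandermonde unitfE; apply/prodf_neq0 => i _; apply/prodf_neq0 => j lt_ij.
  rewrite !mxE subr_eq0; apply: contraTneq lt_ij => /a_inj ->; by rewrite ltnn.
exists (fun j i => invmx V i j) => j l.
have := congr1 (fun A : 'M_n => A l j) (mulmxV uV); rewrite !mxE => <-.
by apply: eq_bigr => i _; rewrite !mxE mulrC.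
Qed.

Lemma divf_exp_eq (F : fieldType) (a b c q : F) i :
  q != 0 -> a * (b / q) ^+ i = c -> a * b ^+ i = c * q ^+ i.
Proof. by move=> q0 <-; rewrite expr_div_n -mulrA divfK // expf_neq0. Qed.

Section Gauss.
Variables (k : fieldType) (char0 : [pchar k] =i pred0) (d : nat).
Let R := {mpoly k[d]}.
Let E := {fraction R}.
Local Notation "x %:F" := (@FracField.tofrac R x).

Definition polynomial_fraction (e : E) := exists r : R, e = r%:F.

Lemma polynomial_fractionD x y :
  polynomial_fraction x -> polynomial_fraction y -> polynomial_fraction (x + y).
Proof. by move=> [r ->] [s ->]; exists (r + s); rewrite rmorphD. Qed.

Lemma polynomial_fractionM x y :
  polynomial_fraction x -> polynomial_fraction y -> polynomial_fraction (x * y).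
Proof. by move=> [r ->] [s ->]; exists (r * s); rewrite rmorphM. Qed.

Lemma polynomial_fraction_sum (J : Type) (r : seq J) (P : pred J) (F : J -> E) :
  (forall j, polynomial_fraction (F j)) -> polynomial_fraction (\sum_(j <- r | P j) F j).
Proof.
move=> hF; elim/big_rec: _ => [|j x _ hx]; first by exists 0; rewrite rmorph0.
exact: polynomial_fractionD.
Qed.

Lemma polynomial_fraction_det n (A : 'M[E]_n) :
  (forall i j, polynomial_fraction (A i j)) -> polynomial_fraction (\det A).
Proof.
move=> hA; apply: polynomial_fraction_sum => s; apply: polynomial_fractionM.
  by exists ((-1) ^+ perm.odd_perm s); rewrite rmorphXn rmorphN rmorph1.
elim/big_rec: _ => [|j x _ hx]; first by exists 1; rewrite rmorph1.
exact: polynomial_fractionM.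
Qed.

Lemma polynomial_fraction_almost_integral (h : R) (e : E) : h != 0 ->
  (forall i, polynomial_fraction (h%:F * e ^+ i)) -> polynomial_fraction e.
Proof.
have [p [q [q0 ->]]] := fractionP e => h0 hi.
have qF0 : q%:F != 0 by rewrite tofrac_eq0.
have [|c ->] := @mpoly_almost_integral k d h p q h0 q0; last first.
  by exists c; rewrite rmorphM mulfK.
move=> i; have [c /(divf_exp_eq qF0) hc] := hi i; exists c; apply/eqP; rewrite -tofrac_eq.
by apply/eqP; rewrite [LHS]tofracM [RHS]tofracM [X in _ * X]tofracXn [X in _ = _ * X]tofracXn.
Qed.

Lemma common_denominator (T : finType) (F : T -> E) :
  exists2 h : R, h != 0 & forall t, polynomial_fraction (h%:F * F t).
Proof.
have hF t : exists q : R, q != 0 /\ polynomial_fraction (q%:F * F t).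
  have [p [q [q0 ->]]] := fractionP (F t); exists q; split=> //; exists p.
  by rewrite mulrC divfK // tofrac_eq0.
pose q t := projT1 (cid (hF t)).
have qP t : q t != 0 /\ polynomial_fraction ((q t)%:F * F t) by rewrite /q; case: cid.
exists (\prod_t q t); first by apply/prodf_neq0 => t _; case: (qP t).
move=> t; rewrite (bigD1 t) //= rmorphM mulrAC; apply: polynomial_fractionM.
  by case: (qP t).
by eexists.
Qed.

(** Modulo the monic [G], polynomials in [C] over [R] reduce to bounded degree, so their entries
    share a denominator [h]. Powers of [\det (a - C)] are determinants of powers of [a - C] and thus
    share the denominator [h ^+ n.+1]; complete integral closedness puts the values of the
    characteristic polynomial in [R], and interpolation its coefficients. *)
Lemma char_poly_polynomial n (C : 'M[E]_n.+1) (G : {poly R}) : G \is monic ->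
  horner_mx C (map_poly (@FracField.tofrac R) G) = 0 ->
  forall j, polynomial_fraction (char_poly C)`_j.
Proof.
move=> monG GC.
have [h h0 hh] := common_denominator
  (fun t : 'I_(size G) * ('I_n.+1 * 'I_n.+1) => (C ^+ t.1) t.2.1 t.2.2).
have hP (P : {poly R}) i j :
    polynomial_fraction (h%:F * (horner_mx C (map_poly (@FracField.tofrac R) P)) i j).
  rewrite (Pdiv.RingMonic.rdivp_eq monG P) !rmorphD !rmorphM /= GC mulr0 add0r.
  have : (size (Pdiv.CommonRing.rmodp P G) <= size G)%N.
    by rewrite ltnW // Pdiv.CommonRing.ltn_rmodp monic_neq0.
  move: (Pdiv.CommonRing.rmodp _ _) => r szr.
  rewrite (_ : map_poly _ r = \sum_(l < size G) (r`_l)%:F *: 'X^l); last first.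
    apply/polyP => l; rewrite coef_map coef_sum /=; have [ltl|lel] := ltnP l (size G).
      rewrite (bigD1 (Ordinal ltl)) //= coefZ coefXn eqxx mulr1 big1 ?addr0 // => l' ne.
      by rewrite coefZ coefXn eq_sym -[l' == l :> nat]/(l' == Ordinal ltl) (negPf ne) mulr0.
    rewrite nth_default ?rmorph0; last exact: leq_trans lel.
    by rewrite big1 // => l' _; rewrite coefZ coefXn eqn_leq leqNgt (leq_trans (ltn_ord l') lel) mulr0.
  rewrite rmorph_sum summxE mulr_sumr; apply: polynomial_fraction_sum => l.
  rewrite /= horner_mxZ rmorphXn /= horner_mx_X mxE mulrCA; apply: polynomial_fractionM.
    by eexists.
  exact: (hh (l, (i, j))).
have hdet a : polynomial_fraction (char_poly C).[a%:F].
  apply: (@polynomial_fraction_almost_integral (h ^+ n.+1)); first exact: expf_neq0.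
  move=> i.
  have -> : (char_poly C).[a%:F] ^+ i = \det (horner_mx C (map_poly (@FracField.tofrac R) ((a%:P - 'X) ^+ i))).
    rewrite rmorphXn rmorphB /= map_polyC map_polyX rmorphXn rmorphB /= horner_mx_C horner_mx_X.
    have -> : (char_poly C).[a%:F] = \det (a%:F%:M - C).
      rewrite /char_poly -[LHS]/(horner_eval a%:F _) -det_map_mx; congr (\det _).
      apply/matrixP => r s; rewrite !mxE /= /horner_eval hornerD hornerN hornerC.
      by rewrite hornerMn hornerX.
    by elim: i => [|i IHi]; rewrite ?expr0 ?det1 // !exprS IHi -det_mulmx.
  rewrite rmorphXn -detZ; apply: polynomial_fraction_det => r s; rewrite mxE; exact: hP.
(* Degree [n.+1] requires [n.+2] nodes. They lie in [k], so that the interpolation coefficients are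
   constants and bring in no denominators. *)
pose a (i : 'I_n.+2) : k := (val i)%:R.
have a_inj : injective a by move=> i j /(natr_inj_char0 char0)/val_inj.
have [lam hlam] := lagrange_coef a_inj.
move=> j; have [ltj|lej] := ltnP j n.+2; last first.
  by rewrite nth_default ?size_char_poly //; exists 0; rewrite rmorph0.
have -> : (char_poly C)`_j =
    \sum_i ((lam (Ordinal ltj) i)%:MP)%:F * (char_poly C).[((a i)%:MP)%:F].
  under eq_bigr do rewrite (@horner_coef_wide _ n.+2) ?size_char_poly // mulr_sumr.
  rewrite exchange_big /= (bigD1 (Ordinal ltj)) //= [X in _ + X]big1 => [|l ne].
    under eq_bigr do rewrite mulrCA.
    rewrite -mulr_sumr addr0 -[LHS]mulr1; congr (_ * _).
    under eq_bigr do rewrite -tofracXn -tofracM -rmorphXn -mpolyCM.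
    rewrite -!rmorph_sum /= [X in X%:MP](hlam (Ordinal ltj) (Ordinal ltj)) eqxx.
    by rewrite mpolyC1 tofrac1.
  under eq_bigr do rewrite mulrCA.
  rewrite -mulr_sumr; apply/eqP; rewrite mulf_eq0; apply/orP; right.
  under eq_bigr do rewrite -tofracXn -tofracM -rmorphXn -mpolyCM.
  rewrite -!rmorph_sum /= [X in X%:MP](hlam (Ordinal ltj) l) (negPf ne).
  by rewrite mpolyC0 tofrac0.
by apply: polynomial_fraction_sum => i; apply: polynomial_fractionM => //; eexists.
Qed.

(** The monic associate [N] of [M] is the characteristic polynomial of its companion matrix, and
    this matrix is annihilated by [G] because [N] divides [G]. *)
Lemma gauss_lead_coef (G M : {poly R}) : G \is monic -> M != 0 ->
  map_poly (@FracField.tofrac R) M %| map_poly (@FracField.tofrac R) G ->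
  exists M' : {poly R}, M = lead_coef M *: M'.
Proof.
move=> monG M0 MG; pose ME := map_poly (@FracField.tofrac R) M.
have c0 : (lead_coef M)%:F != 0 by rewrite tofrac_eq0 lead_coef_eq0.
pose N := (lead_coef M)%:F^-1 *: ME.
have lME : lead_coef ME = (lead_coef M)%:F.
  by rewrite lead_coef_map_eq // ; exact: c0.
have monN : N \is monic by rewrite monicE lead_coefZ lME mulVf.
have NG : N %| map_poly (@FracField.tofrac R) G by rewrite dvdpZl ?invr_eq0.
have hN j : polynomial_fraction N`_j.
  have := companionmxK monN; move: (companionmx N).
  case: (_.-1) => [|n] C charC.
    rewrite -charC /char_poly det_mx00 coef1; exists ((j == 0)%N)%:R.
    by rewrite rmorph_nat.
  rewrite -charC; apply: (char_poly_polynomial monG).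
  have /dvdpP[Q ->] := NG; rewrite rmorphM /= -charC Cayley_Hamilton.
  by rewrite mulr0.
pose r j := projT1 (cid (hN j)).
have rP j : N`_j = (r j)%:F by rewrite /r; case: cid.
exists (\poly_(j < size M) r j); apply/polyP => j; rewrite coefZ coef_poly.
case: ltnP => [ltj|lej]; last by rewrite nth_default // mulr0.
apply/eqP; rewrite -tofrac_eq tofracM -rP /N coefZ mulrA divff // mul1r.
by rewrite coef_map; exact: eqxx.
Qed.
End Gauss.

(** * Varieties and their dimension *)

Local Open Scope classical_set_scope.

(** Each index is taken where [w] attains its minimum over the remaining tail. *)
Lemma nondecreasing_subsequence (w : nat -> nat) : exists t : nat -> nat,
  forall i, (t i < t i.+1)%N /\ (w (t i) <= w (t i.+1))%N.
Proof.
have hg m : exists j, (m <= j)%N /\ forall l, (m <= l)%N -> (w j <= w l)%N.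
  have ex : exists v, `[< exists2 j, (m <= j)%N & w j = v >].
    by exists (w m); apply/asboolP; exists m.
  case: (ex_minnP ex) => v /asboolP[j le_mj <-] vmin; exists j; split=> // l le_ml.
  by apply: vmin; apply/asboolP; exists l.
pose g m := projT1 (cid (hg m)).
have gP m : (m <= g m)%N /\ forall l, (m <= l)%N -> (w (g m) <= w l)%N.
  by rewrite /g; case: cid.
pose fix t i := if i is i'.+1 then g (t i').+1 else g 0%N.
exists t => i; have [lt_t _] := gP (t i).+1; split=> //.
case: i lt_t => [|i] lt_t; first by case: (gP 0%N) => _; apply.
by case: (gP (t i).+1) => _; apply; apply: leq_trans (ltnW lt_t); case: (gP (t i).+1).
Qed.

Lemma dickson n (u : nat -> 'X_{1..n}) : exists i j, (i < j)%N /\ (u i <= u j)%MM.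
Proof.
suff [s hs] : exists s : nat -> nat, forall i, (s i < s i.+1)%N /\
    forall c, c \in enum 'I_n -> (u (s i) c <= u (s i.+1) c)%N.
  exists (s 0%N), (s 1%N); have [lts les] := hs 0%N; split=> //.
  by apply/mnm_lepP => c; apply: les; rewrite mem_enum.
elim: (enum 'I_n) => [|c r [s hs]]; first by exists id.
have [t ht] := nondecreasing_subsequence (fun i => u (s i) c).
have s_mono a b : (a <= b)%N -> (s a <= s b)%N /\
    forall c', c' \in r -> (u (s a) c' <= u (s b) c')%N.
  elim: b => [|b IH]; first by rewrite leqn0 => /eqP ->.
  rewrite leq_eqVlt => /orP[/eqP -> //|/IH[le_s le_u]]; have [lts les] := hs b.
  split; first exact: leq_trans le_s (ltnW lts).
  by move=> c' c'r; apply: leq_trans (le_u c' c'r) (les c' c'r).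
exists (s \o t) => i; have [ltt let_] := ht i; have [le1 le2] := s_mono _ _ ltt; split=> /=.
  by apply: leq_trans le1; case: (hs (t i)).
move=> c'; rewrite inE => /orP[/eqP -> //|c'r].
by have [_ h] := s_mono _ _ (ltnW ltt); apply: h.
Qed.

(** Hilbert's basis theorem. Let [g i] be in [J i.+1] outside [J i] with least leading monomial. By
    Dickson's lemma some leading monomial of [g i] divides that of a later [g j]; subtracting a
    multiple of [g i], which lies in [J j], contradicts the minimality of [g j]. *)
Lemma ideal_ascending_chain (k : fieldType) n (J : nat -> {mpoly k[n]} -> Prop) :
  (forall i, is_ideal (J i)) -> (forall i p, J i p -> J i.+1 p) ->
  ~ forall i, exists2 p, J i.+1 p & ~ J i p.
Proof.
move=> idJ subJ strict.
have J_le i j p : (i <= j)%N -> J i p -> J j p.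
  by move/subnK <-; elim: (j - i)%N => // l IH Jp; rewrite addSn; apply/subJ/IH.
have hmin i : exists p, [/\ J i.+1 p, ~ J i p &
    forall q, J i.+1 q -> ~ J i q -> ~ (mlead q < mlead p)%O].
  apply: contrapT => nmin; have [p] := strict i.
  elim/(well_founded_ind (@ltom_wf n)): {p}(mlead p) {-2}p (erefl (mlead p)) => m IH p mp Jp nJp.
  apply: nmin; exists p; split=> // q Jq nJq lt_qp.
  by apply: (IH (mlead q)) (Jq) (nJq) => //; rewrite -mp.
pose g i := projT1 (cid (hmin i)).
have gP i : [/\ J i.+1 (g i), ~ J i (g i) &
    forall q, J i.+1 q -> ~ J i q -> ~ (mlead q < mlead (g i))%O] by rewrite /g; case: cid.
have g0 i : g i != 0.
  by apply/eqP => gi0; have [_ + _] := gP i; apply; rewrite gi0; apply: ideal0.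
have [i [j [lt_ij le_m]]] := dickson (fun i => mlead (g i)).
have [Jgi _ _] := gP i; have [Jgj nJgj gmin] := gP j.
pose t := (mleadc (g j) / mleadc (g i)) *: 'X_[k, mlead (g j) - mlead (g i)].
have lt0 : mleadc (g j) / mleadc (g i) != 0 by rewrite mulf_neq0 ?invr_eq0 ?mleadc_eq0.
have t0 : t != 0.
  by rewrite -mleadc_eq0 /t mleadZ // mleadXm mcoeffZ mcoeffX eqxx mulr1.
have mt : mlead (t * g i) = mlead (g j) by rewrite mleadM // /t mleadZ // mleadXm submK.
have ct : (t * g i)@_(mlead (g j)) = mleadc (g j).
  rewrite -{1}mt mleadM // mleadcM /t mleadZ // mleadXm mcoeffZ mcoeffX eqxx mulr1.
  by rewrite divfK ?mleadc_eq0.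
have Jt : J j (t * g i) by apply: idealMl => //; apply: J_le Jgi.
have nJ : ~ J j (g j - t * g i) by move=> /(ideal_eqmod (idJ j))/(_ Jt).
apply: (gmin (g j - t * g i)) => //; first by apply: idealB => //; apply: subJ.
rewrite lt_neqAle; apply/andP; split; last first.
  by apply: le_trans (mleadB_le _ _) _; rewrite mt joinxx.
apply/eqP => e; apply: nJ; suff -> : g j - t * g i = 0 by apply: ideal0.
by apply/eqP; rewrite -mleadc_eq0 e mcoeffB ct subrr.
Qed.

Section Vanishing.
Variables (k : fieldType) (K : closedFieldType) (f : {rmorphism k -> K}) (n : nat).
Implicit Types (X Y Z : set 'rV[K]_n) (p : {mpoly k[n]}).

Definition vanishing X p := forall x, X x -> mmap f (x 0) p = 0.

Lemma meval_map_mpoly m (v : 'I_m -> K) (p : {mpoly k[m]}) :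
  (map_mpoly f p).@[v] = mmap f v p.
Proof.
rewrite /map_mpoly -[LHS]/(meval v (mmap _ _ p)) mmap_comp.
by apply: eq_mmap => [c|i] /=; rewrite ?mevalC ?mevalXU.
Qed.

Lemma vanishing_ideal X : is_ideal (vanishing X).
Proof.
split=> [x _|p q hp hq x Xx|a p hp x Xx]; first by rewrite rmorph0.
  by rewrite rmorphD /= hp // hq // addr0.
by rewrite rmorphM /= hp // mulr0.
Qed.

Lemma vanishing_sub X Y p : X `<=` Y -> vanishing Y p -> vanishing X p.
Proof. by move=> XY h x /XY; apply: h. Qed.

Lemma affine_varietyP X : affine_variety f X <->
  forall x : 'rV[K]_n, (forall p, vanishing X p -> mmap f (x 0) p = 0) -> X x.
Proof.
split=> [[I ->] x h p Ip|h].
  by rewrite meval_map_mpoly; apply: h => y /(_ p Ip); rewrite meval_map_mpoly.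
exists (vanishing X); apply/seteqP; split=> x.
  by move=> Xx p hp; rewrite meval_map_mpoly; apply: hp.
by move=> hx; apply: h => p hp; rewrite -meval_map_mpoly; apply: hx.
Qed.

Lemma affine_variety_cut X p : affine_variety f X ->
  affine_variety f (X `&` [set x : 'rV[K]_n | mmap f (x 0) p = 0]).
Proof.
move=> /affine_varietyP vX; apply/affine_varietyP => x hx; split.
  by apply: vX => q hq; apply: hx; apply: vanishing_sub hq; apply: subIsetl.
by apply: hx => y [].
Qed.

Lemma variety_separate X Y : affine_variety f Y -> ~ X `<=` Y ->
  exists2 p, vanishing Y p & ~ vanishing X p.
Proof.
move=> /affine_varietyP vY nXY; apply: contrapT => h; apply: nXY => x Xx.
apply: vY => p hp; apply: contrapT => px; apply: h; exists p => // /(_ x Xx).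
exact: px.
Qed.

Lemma irreducible_prime Z : irreducible f Z -> is_prime_ideal (vanishing Z).
Proof.
move=> [vZ [z Zz] irr]; split; first exact: vanishing_ideal.
  by move=> /(_ z Zz) /eqP; rewrite rmorph1 oner_eq0.
move=> p q hpq; have [||||] := irr (Z `&` [set x : 'rV[K]_n | mmap f (x 0) p = 0])
  (Z `&` [set x : 'rV[K]_n | mmap f (x 0) q = 0]).
- exact: affine_variety_cut.
- exact: affine_variety_cut.
- apply/seteqP; split=> [x Zx|x [[]|[]] //].
  have := hpq x Zx; rewrite rmorphM => /eqP; rewrite mulf_eq0.
  by case/orP => /eqP h; [left|right].
- by move=> e; left => x; rewrite e => -[].
- by move=> e; right => x; rewrite e => -[].
Qed.

(** A strictly descending sequence of varieties would have strictly ascending vanishing ideals. *)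
Lemma minimal_variety (Q : set 'rV[K]_n -> Prop) Y0 : affine_variety f Y0 -> Q Y0 ->
  exists Y, [/\ affine_variety f Y, Q Y, Y `<=` Y0 &
    forall Y', affine_variety f Y' -> Q Y' -> Y' `<=` Y -> Y' = Y].
Proof.
move=> vY0 QY0; apply: contrapT => nmin.
pose T := {Y | [/\ affine_variety f Y, Q Y & Y `<=` Y0]}.
have step (Y : T) : exists Y' : T, sval Y' `<` sval Y.
  case: Y => Y [vY QY YY0] /=; apply: contrapT => h; apply: nmin; exists Y; split=> //.
  move=> Y' vY' QY' Y'Y; apply: contrapT => ne; apply: h.
  exists (exist _ Y' (And3 vY' QY' (subset_trans Y'Y YY0))).
  by rewrite properEneq /=; split=> //; apply/eqP.
pose next (Y : T) : T := projT1 (cid (step Y)).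
have nextP (Y : T) : sval (next Y) `<` sval Y by rewrite /next; case: cid.
pose Y0T : T := exist _ Y0 (And3 vY0 QY0 (@subset_refl _ Y0)).
pose Ys i := iter i next Y0T.
apply: (@ideal_ascending_chain k n (fun i => vanishing (sval (Ys i)))).
- by move=> i; apply: vanishing_ideal.
- by move=> i p; apply: vanishing_sub => /=; case: (nextP (Ys i)).
move=> i; apply: variety_separate; first by case: (svalP (Ys i.+1)).
by case: (nextP (Ys i)).
Qed.
End Vanishing.

(** * Dimension by chains equals transcendence degree *)

Section Dimension.
Variables (k : fieldType) (char0 : [pchar k] =i pred0).
Variables (K : closedFieldType) (f : {rmorphism k -> K}) (n : nat).
Implicit Types (X Y Z : set 'rV[K]_n) (p : {mpoly k[n]}) (ws : seq {mpoly k[n]}).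

Definition coords : seq {mpoly k[n]} := [seq 'X_i | i <- enum 'I_n].

Lemma mem_coords i : 'X_i \in coords.
Proof. by apply: map_f; rewrite mem_enum. Qed.

Lemma coords_gen (I : {mpoly k[n]} -> Prop) : is_prime_ideal I ->
  forall b, exists D, lspan I (monomials coords D) b.
Proof.
move=> prI b; exists (msize b); rewrite {2}[b]mpolyE big_seq.
elim/big_rec: _ => [|m x mb sx]; first exact: lspan0.
apply: lspanD => //; rewrite mpolyXE_id; apply: monomials_prod => [i|].
  exact: mem_coords.
by rewrite -mdegE ltnW // msize_mdeg_lt.
Qed.

Lemma mmap_evs (x : 'I_n -> K) ws (P : {mpoly k[size ws]}) :
  mmap f x (evs ws P) = mmap f (fun i => mmap f x ws`_i) P.
Proof.
rewrite /evs mmap_comp; apply: eq_mmap => // c /=.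
by rewrite alg_mpolyC mmapC.
Qed.

(** Restricting a relation of [h] over [ws] from [Z'] to [Z] kills [h], so its constant term
    vanishes on [Z] and is zero. What remains is divisible by [h], which the prime ideal of [Z']
    allows to cancel. *)
Lemma alg_indep_step Z Z' h ws : is_prime_ideal (vanishing f Z') -> Z `<=` Z' ->
  vanishing f Z h -> ~ vanishing f Z' h -> alg_indep (vanishing f Z) ws ->
  alg_indep (vanishing f Z') (h :: ws).
Proof.
move=> prZ' ZZ' hZ hZ' iw P; rewrite evs_cons => hP.
apply/eqP; rewrite -(shear_eq0 (fun=> 0)); move: hP; set Q := shear _ P.
elim: {Q}(size Q) {-2}Q (leqnn (size Q)) => [|s IH] Q szQ hQ.
  by rewrite -size_poly_leq0.
have Q0 : Q`_0 = 0.
  apply: iw => x Zx; have := hQ x (ZZ' x Zx).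
  rewrite {1}(poly_drop1 Q) rmorphD rmorphM /= map_polyX map_polyC hornerD hornerM hornerX hornerC.
  by rewrite rmorphD rmorphM /= hZ // mul0r add0r.
have eQ : Q = 'X * drop_poly 1 Q by rewrite {1}(poly_drop1 Q) Q0 addr0.
move: hQ; rewrite eQ; set Q1 := drop_poly 1 Q => hQ.
rewrite mulf_eq0 polyX_eq0 /=; apply: IH.
  apply/leq_sizeP => j lej; rewrite /Q1 coef_drop_poly addn1 nth_default //.
  exact: leq_trans szQ _.
move: hQ; rewrite rmorphM /= map_polyX hornerM hornerX.
by case: prZ' => _ _ pr /pr[].
Qed.

Lemma chain_alg_indep X d Zs : irreducible_chain f X d Zs ->
  forall i, (i <= d)%N -> exists2 ws, alg_indep (vanishing f (Zs i)) ws & size ws = i.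
Proof.
move=> [irr sub lt]; elim=> [|i IH] led.
  by exists [::] => //; apply/alg_indep_nil/irreducible_prime/irr.
have [ws iw sw] := IH (ltnW led); have [sub' nsub] := lt i led.
have [vZ _ _] := irr i (ltnW led).
have [h hZ nhZ] := variety_separate vZ nsub.
exists (h :: ws); last by rewrite /= sw.
by apply: alg_indep_step hZ nhZ iw => //; apply/irreducible_prime/irr.
Qed.

Lemma mmap_meval m (v : 'I_m -> k) (p : {mpoly k[m]}) :
  mmap f (f \o v) p = f p.@[v].
Proof. by rewrite [RHS](mmap_comp f idfun). Qed.

(** The variables satisfy equations over [ws] whose leading coefficients survive at [v], so
    evaluation at [v] extends to them. *)
Lemma exists_point Z ws (v : 'I_(size ws) -> k) :
  affine_variety f Z -> is_prime_ideal (vanishing f Z) ->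
  alg_indep (vanishing f Z) ws ->
  forall Q : 'I_n -> {poly {mpoly k[size ws]}},
  (forall i, vanishing f Z (map_poly (evs ws) (Q i)).['X_i]) ->
  (forall i, (lead_coef (Q i)).@[v] != 0) ->
  exists2 x, Z x & forall P, mmap f (x 0) (evs ws P) = f P.@[v].
Proof.
move=> vZ prZ iw Q QZ Qv.
have [||||||x [xZ xv]] := @lift_point k K f n (vanishing f Z) _ {mpoly k[size ws]}
  (@mpolyC _ k) (evs ws) (mmap f (f \o v)) _ _ coords.
- exact: vanishing_ideal.
- by move=> c /=; rewrite /evs mmapC /= alg_mpolyC.
- by move=> c /=; rewrite mmapC.
- by move=> a /iw ->; rewrite rmorph0.
- move=> _ /mapP[i _ ->]; exists (Q i), (size (Q i)).-1; split=> //.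
    exact: leqSpred.
  by rewrite -lead_coefE /= mmap_meval fmorph_eq0.
- move=> i; have ii : (index 'X_i coords < size coords)%N.
    by rewrite index_mem mem_coords.
  exists 0, (fun j => (j == Ordinal ii)%:R); rewrite rmorph0 add0r.
  rewrite (bigD1 (Ordinal ii)) //= eqxx scale1r nth_index ?mem_coords //.
  by rewrite big1 ?addr0 // => j /negPf ->; rewrite scale0r.
have eqx p : mmap f ((\row_i x i) 0) p = mmap f x p by apply: eq_mmap => // i; rewrite mxE.
exists (\row_i x i).
  by move/affine_varietyP: vZ; apply=> p hp; rewrite eqx xZ.
by move=> P; rewrite eqx xv /= mmap_meval.
Qed.

Lemma basis_relations Z ws d : is_prime_ideal (vanishing f Z) ->
  trdeg (vanishing f Z) coords d -> alg_indep (vanishing f Z) ws -> size ws = d ->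
  exists Q : 'I_n -> {poly {mpoly k[size ws]}}, forall i,
    Q i != 0 /\ vanishing f Z (map_poly (evs ws) (Q i)).['X_i].
Proof.
move=> prZ td iw sw.
have hQ i : exists Q : {poly {mpoly k[size ws]}},
    Q != 0 /\ vanishing f Z (map_poly (evs ws) Q).['X_i].
  by have [Q] := trdeg_dependent prZ (coords_gen prZ) 'X_i td iw sw; exists Q.
by have [Q] := choice hQ; exists Q.
Qed.

(** Complete [b :: ws] to a transcendence basis and let [C] be the product of the leading
    coefficients of the equations of the variables. Above every value of the basis with [C] nonzero
    lies a point of [Z]. If the hyperplane [b = c] is not contained in the zero set of [C], it
    carries such values at which a given nonzero polynomial in [ws] does not vanish either. *)
Lemma alg_indep_cut Z b ws : affine_variety f Z -> is_prime_ideal (vanishing f Z) ->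
  alg_indep (vanishing f Z) (b :: ws) ->
  exists c : k, alg_indep
    (vanishing f (Z `&` [set x : 'rV[K]_n | mmap f (x 0) (b - c%:MP) = 0])) ws.
Proof.
move=> vZ prZ ib; have [d td] := trdeg_ex prZ coords.
have [ys [_ iy sy]] := trdeg_basis prZ (coords_gen prZ) td ib.
have [Q hQ] := basis_relations prZ td iy sy.
set full := ys ++ b :: ws in iy sy Q hQ.
have szf : size full = ((size ys).+1 + size ws)%N by rewrite size_cat /= addnS.
have lt_b : (size ys < size full)%N by rewrite szf addSn ltnS leq_addr.
have lt_w (j : 'I_(size ws)) : ((size ys).+1 + j < size full)%N by rewrite szf ltn_add2l.
pose ob := Ordinal lt_b; pose ow j := Ordinal (lt_w j).
have fb : full`_ob = b by rewrite nth_cat ltnn subnn.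
have fw j : full`_(ow j) = ws`_j.
  by rewrite nth_cat /= ltnNge leqW ?leq_addr //= addSn -addnS addKn.
pose C := \prod_i lead_coef (Q i).
have C0 : C != 0 by apply/prodf_neq0 => i _; rewrite lead_coef_eq0; case: (hQ i).
have [v Cv] := mpoly_nonroot char0 C0.
exists (v ob) => P hP; apply/eqP/negP => /negP P0.
have [u Pu] := mpoly_nonroot char0 P0.
pose sub (v' : 'I_(size full) -> k) i := if i == ob then v ob else v' i.
(* [C] restricted to the hyperplane; it is nonzero because its value at [v] is. *)
pose C' := mmap (@mpolyC _ k) (fun i => if i == ob then (v ob)%:MP else 'X_i) C.
pose P' := mmap (@mpolyC (size full) k) (fun j => 'X_(ow j)) P.
have evC v' : C'.@[v'] = C.@[sub v'].
  rewrite /C' (mmap_comp (meval v')); apply: eq_mmap => [c|i] /=; first by rewrite mevalC.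
  by rewrite /sub; case: eqP; rewrite ?mevalC ?mevalXU.
have evP v' : P'.@[v'] = P.@[v' \o ow].
  rewrite /P' (mmap_comp (meval v')); apply: eq_mmap => [c|i] /=; first by rewrite mevalC.
  by rewrite mevalXU.
have C'0 : C' != 0.
  apply: contra_neq Cv => C'0; have := evC v; rewrite C'0 meval0 => ->.
  by apply: meval_eq => i; rewrite /sub; case: eqP => [->|].
have P'0 : P' != 0.
  apply: contra_neq Pu => P'0.
  (* The sum has one term at the positions of [ws] and is empty, hence 0, elsewhere. *)
  pose v' (i : 'I_(size full)) := \sum_(j | ow j == i) u j.
  have := evP v'; rewrite P'0 meval0 => ->; apply: meval_eq => j /=.
  rewrite /v' (big_pred1 j) // => j'; rewrite -val_eqE /= eqn_add2l; exact: val_eqE.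
have [v0] := mpoly_nonroot char0 (mulf_neq0 C'0 P'0).
rewrite mevalM mulf_eq0 negb_or evC => /andP[Cv0 Pv0].
have [|i|x Zx hx] := exists_point (v := sub v0) vZ prZ iy (Q := Q).
- by move=> i; case: (hQ i).
- by move: Cv0; rewrite /C rmorph_prod => /prodf_neq0; apply.
have xb : mmap f (x 0) (b - (v ob)%:MP) = 0.
  rewrite rmorphB /= mmapC; have := hx 'X_ob; rewrite /evs mmapXU fb => ->.
  by rewrite mevalXU /sub eqxx subrr.
have := hP x (conj Zx xb); rewrite mmap_evs => Px.
case/eqP: Pv0; apply: (fmorph_inj f); rewrite rmorph0 -Px evP -mmap_meval.
apply: eq_mmap => // j /=; have := hx 'X_(ow j); rewrite /evs mmapXU fw => ->.
rewrite mevalXU /sub; case: eqP => // /(congr1 val) /=; lia.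
Qed.

(* A variety minimal among those on which [ws] is algebraically independent is
   irreducible. *)
Lemma alg_indep_chain ws : forall Z, irreducible f Z -> alg_indep (vanishing f Z) ws ->
  exists Zs, irreducible_chain f Z (size ws) Zs /\ Zs (size ws) = Z.
Proof.
elim: ws => [|b ws IH] Z irrZ iw; first by exists (fun=> Z); split=> //; split=> // i _ x.
have prZ := irreducible_prime irrZ; have [vZ Z0 _] := irrZ.
have [c ic] := alg_indep_cut vZ prZ iw.
have [|Y [vY iY subY minY]] := minimal_variety (f := f)
    (Q := fun Y => alg_indep (vanishing f Y) ws) _ ic.
  exact: affine_variety_cut.
have irrY : irreducible f Y.
  split=> // [|Y1 Y2 vY1 vY2 eY].
    apply/set0P/eqP => Y0; have /eqP : 1 = 0 :> {mpoly k[size ws]}.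
      by apply: iY => x; rewrite Y0.
    by rewrite oner_eq0.
  apply: contrapT => /not_orP[n1 n2].
  have dep Y' : affine_variety f Y' -> Y' `<=` Y -> Y <> Y' ->
      exists2 P, P != 0 & vanishing f Y' (evs ws P).
    move=> vY' sub ne; apply: contrapT => h; apply/ne/esym/minY => // P hP.
    by apply: contrapT => P0; apply: h; exists P => //; apply/eqP.
  have [||P1 P10 hP1] := dep Y1 vY1; [by rewrite eY; apply: subsetUl | exact: n1 | ].
  have [||P2 P20 hP2] := dep Y2 vY2; [by rewrite eY; apply: subsetUr | exact: n2 | ].
  have : P1 * P2 = 0.
    apply: iY => x; rewrite eY !rmorphM /= => -[/hP1|/hP2] ->; by rewrite ?mul0r ?mulr0.
  by apply/eqP; rewrite mulf_neq0.
have [Zs [[irr sub lt] top]] := IH Y irrY iY.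
have YZ : Y `<=` Z by move=> x /subY[].
(* [b - c] vanishes on [Y] but not on [Z], where [b] is transcendental. *)
have nZY : ~ Z `<=` Y.
  move=> ZY; have := iw ('X_ord0 - c%:MP); rewrite rmorphB /=.
  rewrite /evs mmapXU mmapC /= alg_mpolyC => h.
  have /eqP : 'X_ord0 - c%:MP = 0 :> {mpoly k[(size ws).+1]}.
    by apply: h => x /ZY/subY[].
  rewrite subr_eq0 => /eqP/(congr1 (mcoeff U_(ord0))) /eqP.
  by rewrite mcoeffX eqxx mcoeffC mnm1_eq0 mulr0 oner_eq0.
exists (fun i => if (i <= size ws)%N then Zs i else Z); rewrite /= ltnn; split=> //.
split=> i.
- by move=> _; case: leqP => // lei; apply: irr.
- by move=> _; case: leqP => lei x // /(sub i lei) /YZ.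
rewrite ltnS => lei; rewrite lei; case: leqP => lei'; last exact: lt.
by have -> : i = size ws by [lia]; rewrite top; split.
Qed.

Lemma has_dimension_trdeg Z d : irreducible f Z -> has_dimension f Z d ->
  trdeg (vanishing f Z) coords d.
Proof.
move=> irrZ [[Zs ch] dmax]; have prZ := irreducible_prime irrZ.
have [e te] := trdeg_ex prZ coords; suff -> : d = e by [].
apply/eqP; rewrite eqn_leq; apply/andP; split; last first.
  have [_ [ws iw <-]] := te; have [Zs' [ch' _]] := alg_indep_chain irrZ iw.
  exact: dmax ch'.
have [ws iw <-] := chain_alg_indep ch (leqnn d).
apply: (trdeg_alg_indep_le prZ (coords_gen prZ) te) => P hP; apply: iw.
by have [_ sub _] := ch; apply: vanishing_sub hP; apply: sub.
Qed.
End Dimension.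

(** * Relations of degree at most the degree of a variety *)

Section MinimalRelation.
Variables (k : fieldType) (char0 : [pchar k] =i pred0).
Variables (B : comAlgType k) (I : B -> Prop) (prI : is_prime_ideal I).
Let idI : is_ideal I. Proof. by case: prI. Qed.

(* [alg_indep] for a family indexed by ['I_m]; it is [alg_indep] itself when the
   family is that of the entries of a sequence. *)
Definition alg_indep_fun m (w : 'I_m -> B) :=
  forall P : {mpoly k[m]}, I (mmap (in_alg B) w P) -> P = 0.

(** Relations in a fixed number of variables suit families indexed by ['I_m], whereas extending
    independent families suits sequences; this passes between the two. *)
Lemma seq_of_fun m (w : 'I_m -> B) : exists (ws : seq B) (e : size ws = m),
  forall i : 'I_(size ws), ws`_i = w (cast_ord e i).
Proof.
have e : size [seq w i | i <- enum 'I_m] = m by rewrite size_map size_enum_ord.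
exists [seq w i | i <- enum 'I_m], e => i.
have im : (i < m)%N by have := ltn_ord i; move: (nat_of_ord i) => i'; rewrite e.
rewrite (nth_map (Ordinal im)) ?size_enum_ord //; congr (w _); apply/val_inj.
by rewrite /= nth_enum_ord.
Qed.

Lemma alg_indep_seq_of_fun m (w : 'I_m -> B) ws (e : size ws = m) :
  (forall i : 'I_(size ws), ws`_i = w (cast_ord e i)) -> alg_indep_fun w -> alg_indep I ws.
Proof.
case: m / e w => w hw iw P hP; apply: iw; move: hP; congr (I _).
by apply: eq_mmap => // i; rewrite hw cast_ord_id.
Qed.

(** As [S] has a constant leading coefficient, [l0] is algebraic over the [z j], and the [w j] lie
    in the span of [l0] and the [z j]. If [z] were dependent, the growth exponent would be below
    [m], too small for the [m] independent elements [w j]. *)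
Lemma sheared_alg_indep m (w z : 'I_m -> B) l0 (v : 'I_m -> k) (S : {poly {mpoly k[m]}}) c :
  alg_indep_fun w -> (forall j, w j = z j + v j *: l0) ->
  lead_coef S = c%:MP -> c != 0 ->
  I (map_poly (mmap (in_alg B) z) S).[l0] -> alg_indep_fun z.
Proof.
have [zs [e hz]] := seq_of_fun z; case: m / e z hz w v S => z hz w v S iw wz lS c0 IS.
have zE j : z j = zs`_j by rewrite hz cast_ord_id.
have {}IS : I (map_poly (evs zs) S).[l0].
  move: IS; congr (I _); congr (_.[_]); apply: eq_map_poly => p.
  by apply: eq_mmap => // j.
suff iz : alg_indep I zs.
  by move=> P hP; apply: iz; move: hP; congr (I _); apply: eq_mmap => // j.
have [ys [sub iy gy]] := alg_indep_extend prI zs (alg_indep_nil prI).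
rewrite !cats0 in iy gy.
have := size_subseq_leqif sub => -[le_s eq_s].
have [lt_s|ge_s] := ltnP (size ys) (size zs); last first.
  have : size ys == size zs by rewrite eqn_leq le_s.
  by rewrite eq_s => /eqP <-.
have S0 : S != 0 by rewrite -lead_coef_eq0 lS mpolyC_eq0.
have gl0 : growth I (l0 :: zs) (size ys).
  apply: growth_algebraic => //.
  exists (size S).-1, (\max_(i < size S) msize S`_i), (fun j => evs zs S`_j); split.
  - move=> j; have [ltj|lej] := ltnP j (size S); last first.
      by rewrite nth_default // rmorph0; apply: lspan0.
    apply: (lspan_sub prI _ (lspan_evs prI S`_j)) => a; apply: monomials_le.
    exact: (leq_bigmax (F := fun i : 'I_(size S) => msize S`_i) (Ordinal ltj)).
  - rewrite -lead_coefE lS /evs mmapC /= => Ic; case: prI => _ + _; apply.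
    by rewrite -[1]/(1 : B) -(scale1r (1 : B)) -(mulVf c0) -scalerA -mulr_algl; apply: idealMl.
  move: IS; rewrite (@horner_coef_wide _ (size S)) ?size_poly //.
  rewrite prednK ?lt0n ?size_poly_eq0 //.
  by under eq_bigr do rewrite coef_map.
have [ws' [e' hw]] := seq_of_fun w.
have iw' := alg_indep_seq_of_fun hw iw.
suff : (size ws' <= size ys)%N by rewrite e' leqNgt lt_s.
apply: (alg_indep_growth prI gl0) iw'.
exists 1%N => y /(nthP 0)[i lti <-]; rewrite (hw (Ordinal lti)) wz zE addrC.
apply: lspanD.
  by rewrite -[X in monomials _ _ X]mulr1; apply: monomialsM; rewrite ?mem_head //; apply: monomials1.
apply: lspan_mem => //; rewrite -[X in monomials _ _ X]mulr1; apply: monomialsM; last exact: monomials1.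
by rewrite inE mem_nth ?orbT //= -e'.
Qed.

Variables (m : nat) (z : 'I_m -> B) (iz : alg_indep_fun z) (l0 : B).
Let relation (M : {poly {mpoly k[m]}}) := I (map_poly (mmap (in_alg B) z) M).[l0].

Let relD M N : relation M -> relation N -> relation (M + N).
Proof. by rewrite /relation rmorphD hornerD; apply: idealD. Qed.
Let relM M N : relation N -> relation (M * N).
Proof. by rewrite /relation rmorphM hornerM; apply: idealMl. Qed.
Let relN M : relation M -> relation (- M).
Proof. by rewrite -mulN1r; apply: relM. Qed.
Let relP M N : relation (M * N) -> relation M \/ relation N.
Proof. by rewrite /relation rmorphM hornerM; case: prI => _ _; apply. Qed.
Let relC p : relation p%:P -> p = 0.
Proof. by rewrite /relation map_polyC hornerC; apply: iz. Qed.

(* [S] is monic of minimal total degree; a relation [M] of smaller degree in the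
   last variable would, by Gauss's lemma, yield a monic factor of [S]. *)
Lemma minimal_relation (v : 'I_m -> k) (G : {mpoly k[m.+1]}) c :
  let S := shear v G in
  G != 0 -> lead_coef S = c%:MP -> c != 0 -> relation S ->
  (forall H, H != 0 -> relation (shear v H) -> (msize G <= msize H)%N) ->
  forall M, M != 0 -> relation M -> (size S <= size M)%N.
Proof.
move=> S G0 lS c0 relS minG.
have ex : exists s, `[< exists M, [/\ M != 0, relation M & size M = s] >].
  by exists (size S); apply/asboolP; exists S; rewrite shear_eq0.
case: (ex_minnP ex) => s /asboolP[M [M0 relM0 szM]] smin.
suff : (size S <= size M)%N.
  by move=> leM N N0 relN0; apply: leq_trans leM _; rewrite szM smin //; apply/asboolP; exists N.
have small N : relation N -> (size N < size M)%N -> N = 0.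
  move=> relN0 ltN; apply/eqP; apply: contraTT ltN => N0; rewrite -leqNgt szM.
  by apply: smin; apply/asboolP; exists N.
(* The pseudo-remainder is a relation of degree below the minimum, so [M] divides [S] over the
   fraction field. *)
have rem0 : S %% M = 0.
  apply: small; last by rewrite ltn_modp.
  have -> : S %% M = (lead_coef M ^+ scalp S M)%:P * S - S %/ M * M.
    by rewrite mul_polyC Pdiv.Idomain.divp_eq addrC addKr.
  by apply: relD; [apply: relM | apply/relN/relM].
pose G1 := c^-1%:MP *: S.
have monG1 : G1 \is monic.
  by rewrite monicE lead_coefZ lS -mpolyCM mulVf // mpolyC1.
have MG1 : map_poly (@FracField.tofrac {mpoly k[m]}) M %|
           map_poly (@FracField.tofrac {mpoly k[m]}) G1.
  have cn0 : @FracField.tofrac {mpoly k[m]} c^-1%:MP != 0.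
    by rewrite tofrac_eq0 mpolyC_eq0 invr_eq0.
  rewrite /G1 -mul_polyC rmorphM /= map_polyC /= mul_polyC dvdpZr //.
  have ln0 : @FracField.tofrac {mpoly k[m]} (lead_coef M ^+ scalp S M) != 0.
    by rewrite tofrac_eq0 expf_neq0 // lead_coef_eq0.
  rewrite -(dvdpZr _ _ ln0) -map_polyZ Pdiv.Idomain.divp_eq rem0 addr0 rmorphM.
  exact: dvdp_mull.
have [M' eM] := gauss_lead_coef char0 monG1 M0 MG1.
have lM0 : lead_coef M != 0 by rewrite lead_coef_eq0.
have monM' : M' \is monic.
  by apply/eqP/(mulfI lM0); rewrite -lead_coefZ -eM mulr1.
have relM' : relation M'.
  have /relP[/relC /eqP|//] : relation ((lead_coef M)%:P * M') by rewrite mul_polyC -eM.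
  by rewrite (negPf lM0).
have szM' : size M' = size M by rewrite eM size_scale.
have eS := Pdiv.RingMonic.rdivp_eq monM' S.
set Q := Pdiv.CommonRing.rdivp _ _ in eS; set N := Pdiv.CommonRing.rmodp _ _ in eS.
have N0 : N = 0.
  apply: small; last by rewrite -szM' Pdiv.CommonRing.ltn_rmodp monic_neq0.
  have -> : N = S - Q * M' by rewrite eS addrC addKr.
  by apply: relD => //; apply/relN/relM.
rewrite N0 addr0 in eS.
have eG : G = unshear v Q * unshear v M' by rewrite -rmorphM /= -eS /S shearK.
have uM'0 : unshear v M' != 0.
  by rewrite -(shear_eq0 v) unshearK monic_neq0.
have uQ0 : unshear v Q != 0 by apply: contra_neq G0; rewrite eG => ->; rewrite mul0r.
(* With the shear undone, [M'] competes with [G] for least total degree, which forces the cofactor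
   to be a constant. *)
have leG : (msize G <= msize (unshear v M'))%N 
  by apply: (minG _ uM'0); rewrite unshearK.
have szQ : (msize (unshear v Q) <= 1)%N.
  move: leG; rewrite eG msizeM //; have := mpolySpred mdeg uM'0.
  by move: (msize _) (msize _) => a b; lia.
have := msize1_polyC szQ; set a := _@_ _ => ea.
rewrite eS -(unshearK v Q) ea /shear mmapC /=.
by rewrite mul_polyC (leq_trans (size_scale_leq _ _)) // szM'.
Qed.

(** If [S] had a nonconstant factor in common with its derivative, which is nonzero in
    characteristic 0, then [S] would split up to a nonzero coefficient, and by primality a factor
    would be a relation of smaller degree. So the resultant is nonzero and serves as [delta]. *)
Lemma separable_relation (S : {poly {mpoly k[m]}}) c :
  lead_coef S = c%:MP -> c != 0 -> relation S ->
  (forall M, M != 0 -> relation M -> (size S <= size M)%N) ->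
  exists (U V : {poly {mpoly k[m]}}) delta,
    delta != 0 /\ U * S + V * S^`() = delta%:P.
Proof.
move=> lS c0 relS minS.
have S0 : S != 0 by rewrite -lead_coef_eq0 lS mpolyC_eq0.
have szS : (1 < size S)%N.
  rewrite ltnNge; apply/negP => sz1; have eS := size1_polyC sz1.
  by have := relS; rewrite eS => /relC; apply/eqP; rewrite -polyC_eq0 -eS.
have lS' : S^`()`_(size S).-2 = (c *+ (size S).-1)%:MP.
  have e2 : (size S).-2.+1 = (size S).-1 by move: szS; clear; case: (size S) => [|[]].
  by rewrite coef_deriv e2 -lead_coefE lS mpolyCMn.
have S'0 : S^`() != 0.
  apply: contra_neq c0 => e; move/eqP: lS'; rewrite e coef0 eq_sym mpolyC_eq0.
  rewrite -mulr_natr mulf_eq0 => /orP[/eqP //|]; move/pcharf0P: char0 => ->.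
  by rewrite -subn1 subn_eq0 leqNgt szS.
(* The Bezout identity for the resultant wants both polynomials nonconstant; a constant derivative
   is its own [delta]. *)
have [le1|gt1] := leqP (size S^`()) 1.
  exists 0, 1, S^`()`_0; rewrite mul0r add0r mul1r -size1_polyC //; split=> //.
  by rewrite -polyC_eq0 -size1_polyC.
have [[U V] _ /= e] := resultant_in_ideal szS gt1.
exists U, V, (resultant S S^`()); split=> //; rewrite resultant_eq0 -leqNgt.
rewrite leqNgt; apply/negP => gtg; set g := gcdp _ _ in gtg.
have /Pdiv.Idomain.dvdpP[[a q] /= a0 eaS] : g %| S by apply: dvdp_gcdl.
have q0 : q != 0.
  by apply/eqP => q0; move/eqP: eaS; rewrite q0 mul0r -mul_polyC mulf_eq0 polyC_eq0 (negPf a0) (negPf S0).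
have g0 : g != 0 by rewrite -size_poly_gt0 (ltn_trans _ gtg).
have leg : (size g < size S)%N.
  apply: leq_ltn_trans (dvdp_leq S'0 (dvdp_gcdr _ _)) _; exact: lt_size_deriv.
have : relation (q * g) by rewrite -eaS -mul_polyC; apply: relM.
have := congr1 (fun p : {poly _} => size p) eaS; rewrite size_scale // size_mul // => esz.
case/relP => [/(minS _ q0)|/(minS _ g0)]; last by rewrite leqNgt leg.
by move: esz gtg; move: (size S) (size q) (size g) => s1 s2 s3; lia.
Qed.
End MinimalRelation.

Local Open Scope card_scope.

(** * Counting points on generic linear slices *)

Section HypersurfaceDegree.
Variables (k : fieldType) (char0 : [pchar k] =i pred0).
Variables (K : closedFieldType) (f : {rmorphism k -> K}) (n : nat).
Implicit Types (Z : set 'rV[K]_n) (p : {mpoly k[n]}) (zs : seq {mpoly k[n]}).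

Definition linear_form p := exists a : 'I_n -> k, p = \sum_i a i *: 'X_i.

Lemma linear_form_sum m (F : 'I_m -> {mpoly k[n]}) (a : 'I_m -> k) :
  (forall j, linear_form (F j)) -> linear_form (\sum_j a j *: F j).
Proof.
move=> /choice[b hb]; exists (fun i => \sum_j a j * b j i).
under eq_bigr do rewrite hb scaler_sumr.
rewrite exchange_big; apply: eq_bigr => i _; rewrite scaler_suml.
by apply: eq_bigr => j _; rewrite scalerA.
Qed.

Lemma linear_formB p q (a : k) : linear_form p -> linear_form q -> linear_form (p - a *: q).
Proof.
move=> [b ->] [c ->]; exists (fun i => b i - a * c i).
rewrite scaler_sumr -sumrB; apply: eq_bigr => i _.
by rewrite scalerBl scalerA.
Qed.

Lemma linear_formX i : linear_form 'X_i.
Proof.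
exists (fun j => (j == i)%:R); rewrite (bigD1 i) //= eqxx scale1r big1 ?addr0 //.
by move=> j /negPf ->; rewrite scale0r.
Qed.

(** Algebraic independence makes the coefficient vectors linearly independent, so the codimension is
    exactly [size zs]. *)
Lemma linear_slice Z zs (x0 : 'rV[K]_n) : is_prime_ideal (vanishing f Z) ->
  alg_indep (vanishing f Z) zs -> (forall j : 'I_(size zs), linear_form zs`_j) ->
  linear_subspace_of_codim (size zs)
    [set x : 'rV[K]_n | forall j : 'I_(size zs), mmap f (x 0) zs`_j = mmap f (x0 0) zs`_j].
Proof.
move=> prZ iz /choice[a ha]; pose A : 'M[k]_(n, size zs) := \matrix_(i, j) a j i.
have evz (x : 'rV[K]_n) (j : 'I_(size zs)) : mmap f (x 0) zs`_j = (x *m map_mx f A) 0 j.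
  rewrite ha rmorph_sum mxE; apply: eq_bigr => i _.
  by rewrite /= mmapZ mmapXU !mxE mulrC.
have rA : \rank A = size zs.
  apply/eqP; rewrite -mxrank_tr -/(row_free A^T); apply: inj_row_free => u uA.
  have : \sum_j u 0 j *: 'X_j = 0 :> {mpoly k[size zs]}.
    apply: iz; rewrite rmorph_sum /=.
    have -> : \sum_(j < size zs) evs zs (u 0 j *: 'X_j) = 0; last exact: (ideal0 (vanishing_ideal f Z)).
    under eq_bigr do rewrite /evs mmapZ mmapXU /= alg_mpolyC mul_mpolyC ha scaler_sumr.
    rewrite exchange_big big1 // => i _; have := congr1 (fun M : 'rV_n => M 0 i) uA.
    rewrite !mxE => e; under eq_bigr do rewrite scalerA.
    rewrite -scaler_suml; rewrite (_ : \sum_j _ = 0) ?scale0r //.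
    by rewrite -[RHS]e; apply: eq_bigr => j _; rewrite !mxE.
  move=> e; apply/rowP => j; move/(congr1 (mcoeff U_(j))): e.
  rewrite mcoeff0 raddf_sum (bigD1 j) //= mcoeffZ mcoeffX eqxx mulr1 big1 => [|l ne].
    by rewrite addr0 mxE.
  by rewrite mcoeffZ mcoeffX eq_mnm1 (negPf ne) mulr0.
exists x0, (kermx (map_mx f A)); split.
  by rewrite mxrank_ker mxrank_map rA subnK // -rA rank_leq_row.
apply/seteqP; split=> x /=.
  move=> h; apply/sub_kermxP/rowP => j; rewrite mulmxBl !mxE.
  by have := h j; rewrite !evz !mxE => ->; rewrite subrr.
move=> /sub_kermxP h j; rewrite !evz; have := congr1 (fun M : 'rV_(size zs) => M 0 j) h.
by rewrite mulmxBl !mxE => /eqP; rewrite subr_eq0 => /eqP.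
Qed.

Lemma finite_coordinate_roots (q : 'I_n -> {poly K}) : (forall i, q i != 0) ->
  finite_set [set x : 'rV[K]_n | forall i, root (q i) (x 0 i)].
Proof.
move=> q0; have hr i : exists rs : seq K, forall a, root (q i) a -> a \in rs.
  have [rs e] := closed_field_poly_normal (q i); exists rs => a.
  by rewrite e rootZ ?lead_coef_eq0 // root_prod_XsubC.
have [rs hrs] := choice hr.
pose N := \max_i size (rs i).
apply: (@sub_finite_set _ _ [set (\row_i (rs i)`_(g i)) | g in [set: {ffun 'I_n -> 'I_N.+1}]]);
  last by apply: finite_image; apply: finite_finset.
move=> x /= hx.
have lt_i (i : 'I_n) : (index (x 0%R i) (rs i) < N.+1)%N.
  rewrite (leq_trans (n := size (rs i))) ?index_mem ?hrs // leqW //.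
  exact: (leq_bigmax (F := fun i => size (rs i))).
exists [ffun i => Ordinal (lt_i i)] => //; apply/rowP => i; rewrite mxE ffunE /=.
by rewrite nth_index // hrs.
Qed.

Lemma irreducible_degree_ge Z d e (L : set 'rV[K]_n) D (P : 'I_D -> 'rV[K]_n) :
  irreducible f Z -> trdeg (vanishing f Z) (coords k n) d ->
  has_irreducible_degree f Z e -> linear_subspace_of_codim d L ->
  finite_set (Z `&` L) -> (forall i, (Z `&` L) (P i)) -> injective P -> (D <= e)%N.
Proof.
move=> irrZ td [d' dimZ [_ maxe]] codL finZL ZLP P_inj.
have ed : d' = d.
  have prZ := irreducible_prime irrZ.
  have td' := has_dimension_trdeg char0 irrZ dimZ.
  exact: (trdeg_inj prZ (coords_gen prZ) td' td).
subst d'.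
have [m cm] := (finite_setP (Z `&` L)).1 finZL.
apply: leq_trans (maxe L m codL cm).
rewrite -card_le_II.
have := card_le_eqr (C := `I_D) cm => <-.
pose g x := if pselect (exists i, P i = x) is left h then val (projT1 (cid h)) else D.
apply: card_le_trans (card_image_le g (Z `&` L)); apply: subset_card_le => i /= lt_i.
exists (P (Ordinal lt_i)); first exact: ZLP.
rewrite /g; case: pselect => [h|[]]; last by exists (Ordinal lt_i).
by case: cid => j /= /P_inj ->.
Qed.
End HypersurfaceDegree.

Section HypersurfaceBound.
Variables (k : fieldType) (char0 : [pchar k] =i pred0).
Variables (K : closedFieldType) (f : {rmorphism k -> K}) (n : nat).
Implicit Types (Z : set 'rV[K]_n) (p : {mpoly k[n]}) (zs : seq {mpoly k[n]}).

(** Having least degree and a constant leading coefficient, [S] divides every relation of [l0] over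
    [zs]. Hence sending [zs] to a base point and [l0] to any root of [S] over it respects all
    relations, and this assignment extends to a point of [Z]; distinct roots give distinct
    points. *)
Lemma generic_slice_degree Z zs l0 (S : {poly {mpoly k[size zs]}}) c e :
  irreducible f Z -> trdeg (vanishing f Z) (coords k n) (size zs) ->
  has_irreducible_degree f Z e -> alg_indep (vanishing f Z) zs ->
  (forall j : 'I_(size zs), linear_form zs`_j) ->
  lead_coef S = c%:MP -> c != 0 -> vanishing f Z (map_poly (evs zs) S).[l0] ->
  (forall M, M != 0 -> vanishing f Z (map_poly (evs zs) M).[l0] -> (size S <= size M)%N) ->
  ((size S).-1 <= e)%N.
Proof.
move=> irrZ td degZ iz linz lS c0 relS minS.
have prZ := irreducible_prime irrZ; have [vZ _ _] := irrZ.
have idZ := vanishing_ideal f Z.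
have [U [V [delta [delta0 UV]]]] := separable_relation char0 prZ iz lS c0 relS minS.
have [Q hQ] := basis_relations prZ td iz erefl.
have C0 : \prod_i lead_coef (Q i) != 0.
  by apply/prodf_neq0 => i _; rewrite lead_coef_eq0; case: (hQ i).
(* A nonzero [delta] makes the roots distinct; nonzero leading coefficients make the points lift and
   the slice finite. *)
have [z0] := mpoly_nonroot char0 (mulf_neq0 delta0 C0).
rewrite mevalM mulf_eq0 negb_or => /andP[dz0 Cz0].
have Qz0 i : (lead_coef (Q i)).@[z0] != 0.
  by move: Cz0; rewrite rmorph_prod => /prodf_neq0; apply.
pose ev : {rmorphism {mpoly k[size zs]} -> K} := mmap f (f \o z0).
have evE P : ev P = f P.@[z0] by rewrite -mmap_meval.
pose p0 := map_poly ev S.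
have evS0 : ev (lead_coef S) != 0 by rewrite lS evE mevalC fmorph_eq0.
have lp0 : lead_coef p0 = f c.
  have -> : lead_coef p0 = ev (lead_coef S) by apply: lead_coef_map_eq.
  by rewrite lS evE mevalC.
have szp0 : size p0 = size S by apply: size_map_poly_id0.
have p00 : p0 != 0 by rewrite -lead_coef_eq0 lp0 fmorph_eq0.
have sep0 : separable_poly p0.
  rewrite separable_poly.unlock; apply/Bezout_coprimepP; exists (map_poly ev U, map_poly ev V) => /=.
  rewrite deriv_map -!rmorphM -rmorphD UV /= map_polyC /=.
  by rewrite -size_poly_eq1 size_polyC evE fmorph_eq0 dz0.
have [rs ers] := closed_field_poly_normal p0.
have urs : uniq rs.
  move: sep0; rewrite ers -separable_prod_XsubC !separable_poly.unlock derivZ.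
  by rewrite coprimepZl ?coprimepZr // lead_coef_eq0.
have szrs : size rs = (size S).-1.
  by rewrite -szp0 ers size_scale ?lead_coef_eq0 // size_prod_XsubC.
pose A : comNzRingType := {poly {mpoly k[size zs]}}.
pose al : {rmorphism A -> {mpoly k[n]}} := horner_morph (fun x => mulrC l0 (evs zs x)).
have relD M : al M = (map_poly (evs zs) M).[l0] by [].
have hpt (i : 'I_(size rs)) : exists x : 'rV[K]_n, [/\ Z x,
    forall j : 'I_(size zs), mmap f (x 0) zs`_j = f (z0 j) & mmap f (x 0) l0 = rs`_i].
  set r := rs`_i.
  have rr : root p0 r by rewrite ers rootZ ?lead_coef_eq0 // root_prod_XsubC mem_nth.
  pose ph : {rmorphism A -> K} := horner_morph (fun x => mulrC r (ev x)).
  have phE M : ph M = (map_poly ev M).[r] by [].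
  pose cA : {rmorphism k -> A} := polyC \o @mpolyC (size zs) k.
  have [|||||x [xZ xa]] := @lift_point k K f n (vanishing f Z) idZ A cA al ph _ _ (coords k n).
  - by move=> a /=; rewrite relD /= map_polyC hornerC /= /evs mmapC /= alg_mpolyC.
  - by move=> a /=; rewrite phE /= map_polyC hornerC /= evE mevalC.
  - move=> M relM.
    have monS : c^-1%:MP *: S \is monic.
      by rewrite monicE lead_coefZ lS -mpolyCM mulVf // mpolyC1.
    have eM := Pdiv.RingMonic.rdivp_eq monS M.
    set q := Pdiv.CommonRing.rdivp _ _ in eM; set N := Pdiv.CommonRing.rmodp _ _ in eM.
    have N0 : N = 0.
      apply/eqP; apply: contraT => N0; have : (size N < size S)%N.
        rewrite -(size_scale S (_ : c^-1%:MP != 0)) ?mpolyC_eq0 ?invr_eq0 //.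
        by rewrite Pdiv.CommonRing.ltn_rmodp monic_neq0.
      rewrite ltnNge (minS _ N0) //; have -> : N = M - q * (c^-1%:MP *: S) by rewrite {1}eM addrC addKr.
      rewrite -relD rmorphB rmorphM -mul_polyC rmorphM; apply: (idealB idZ) => //.
      exact: (idealMl idZ _ (idealMl idZ _ relS)).
    rewrite eM N0 addr0 !rmorphM -mul_polyC rmorphM [ph S]phE.
    by move/rootP: rr => ->; rewrite !mulr0.
  - move=> _ /mapP[i' _ ->]; exists (map_poly polyC (Q i')), (size (Q i')).-1; split.
    + rewrite -map_poly_comp; case: (hQ i') => _; congr (vanishing f Z _.[_]).
      by apply: eq_map_poly => P /=; rewrite relD /= map_polyC hornerC.
    + by rewrite size_map_poly_id0 ?leqSpred // polyC_eq0 lead_coef_eq0; case: (hQ i').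
    + by rewrite coef_map phE /= map_polyC hornerC /= -lead_coefE evE fmorph_eq0.
  - move=> i'; have ii : (index 'X_i' (coords k n) < size (coords k n))%N.
      by rewrite index_mem mem_coords.
    exists 0, (fun j => (j == Ordinal ii)%:R); rewrite rmorph0 add0r.
    rewrite (bigD1 (Ordinal ii)) //= eqxx scale1r nth_index ?mem_coords //.
    by rewrite big1 ?addr0 // => j /negPf ->; rewrite scale0r.
  have eqx p : mmap f ((\row_i x i) 0) p = mmap f x p by apply: eq_mmap => // j; rewrite mxE.
  exists (\row_i x i); split.
  - by move/affine_varietyP: vZ; apply=> p hp; rewrite eqx xZ.
  - move=> j; rewrite eqx; have := xa ('X_j)%:P.
    by rewrite relD phE !map_polyC !hornerC /= /evs mmapXU evE mevalXU.
  - by rewrite eqx; have := xa 'X; rewrite relD phE !map_polyX !hornerX.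
have [P hP] := choice hpt.
(* [S] is not constant because [zs] is independent; so there is a first point, through which the
   slice [L] is drawn. *)
have szS : (0 < size rs)%N.
  rewrite szrs -subn1 subn_gt0 ltnNge; apply/negP => sz1; have eS := size1_polyC sz1.
  have := relS; rewrite eS map_polyC hornerC => /iz; apply/eqP.
  by rewrite -polyC_eq0 -eS -lead_coef_eq0 lS mpolyC_eq0.
pose L := [set x : 'rV[K]_n | forall j : 'I_(size zs),
  mmap f (x 0) zs`_j = mmap f (P (Ordinal szS) 0) zs`_j].
rewrite -szrs; apply: (@irreducible_degree_ge k char0 K f n Z _ e L _ P irrZ td degZ).
- exact: (linear_slice _ prZ iz linz).
- apply: sub_finite_set (finite_coordinate_roots (q := fun i => map_poly ev (Q i)) _).
    move=> x [Zx Lx] i; case: (hQ i) => _ /(_ x Zx); rewrite -horner_map /=.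
    rewrite mmapXU -map_poly_comp => /eqP; rewrite -[_ == _]/(root _ _).
    congr (root _ _); apply: eq_map_poly => p /=; rewrite mmap_evs evE -mmap_meval.
    apply: eq_mmap => // j; rewrite Lx; by have [_ -> _] := hP (Ordinal szS).
  move=> i; have lQ : ev (lead_coef (Q i)) != 0 by rewrite evE fmorph_eq0.
  by rewrite -lead_coef_eq0 lead_coef_map_eq.
- move=> i; have [Zi zi _] := hP i; split=> // j; rewrite zi.
  by have [_ -> _] := hP (Ordinal szS).
move=> i j e_ij; have [_ _ ri] := hP i; have [_ _ rj] := hP j.
by apply/val_inj/eqP; rewrite -(nth_uniq 0 (ltn_ord i) (ltn_ord j) urs) -ri -rj e_ij.
Qed.

Lemma generic_slice_degree_fun Z d (z : 'I_d -> {mpoly k[n]}) l0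
    (S : {poly {mpoly k[d]}}) c e :
  irreducible f Z -> trdeg (vanishing f Z) (coords k n) d ->
  has_irreducible_degree f Z e -> alg_indep_fun (vanishing f Z) z ->
  (forall j, linear_form (z j)) -> lead_coef S = c%:MP -> c != 0 ->
  vanishing f Z (map_poly (mmap (in_alg {mpoly k[n]}) z) S).[l0] ->
  (forall M, M != 0 -> vanishing f Z (map_poly (mmap (in_alg {mpoly k[n]}) z) M).[l0] ->
    (size S <= size M)%N) ->
  ((size S).-1 <= e)%N.
Proof.
have [zs [ez hz]] := seq_of_fun z; case: d / ez z hz S => z hz S.
have evz M : (map_poly (mmap (in_alg {mpoly k[n]}) z) M).[l0] = (map_poly (evs zs) M).[l0].
  have e_ev P : mmap (in_alg {mpoly k[n]}) z P = evs zs P.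
    by apply: eq_mmap => [//|j]; rewrite hz cast_ord_id.
  by rewrite (eq_map_poly e_ev).
move=> irrZ td degZ iz linz lS c0; rewrite evz => relS minS.
have izs : alg_indep (vanishing f Z) zs by apply: (alg_indep_seq_of_fun hz).
have linzs (j : 'I_(size zs)) : linear_form zs`_j by rewrite hz cast_ord_id.
apply: (generic_slice_degree irrZ td degZ izs linzs lS c0 relS).
by move=> M M0; rewrite -evz; apply: minS.
Qed.

Lemma hypersurface_degree Z d e (w : 'I_d -> {mpoly k[n]}) l0 :
  irreducible f Z -> trdeg (vanishing f Z) (coords k n) d ->
  has_irreducible_degree f Z e -> alg_indep_fun (vanishing f Z) w ->
  (forall j, linear_form (w j)) -> linear_form l0 ->
  exists G : {mpoly k[d.+1]}, [/\ G != 0, (msize G <= e.+1)%N &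
    vanishing f Z (mmap (in_alg {mpoly k[n]}) (fcons l0 w) G)].
Proof.
move=> irrZ td degZ iw linw linl.
have prZ := irreducible_prime irrZ.
have [ws [ew hw]] := seq_of_fun w.
have ex : exists s, `[< exists G : {mpoly k[d.+1]}, [/\ G != 0,
    vanishing f Z (mmap (in_alg {mpoly k[n]}) (fcons l0 w) G) & msize G = s] >].
  have iws := alg_indep_seq_of_fun hw iw.
  case: d / ew w hw linw iw td => w hw linw iw td.
  have [M M0 relM] := trdeg_dependent prZ (coords_gen prZ) l0 td iws erefl.
  exists (msize (unshear (fun=> 0) M)); apply/asboolP; exists (unshear (fun=> 0) M); split=> //.
    by rewrite -(shear_eq0 (fun=> 0)) unshearK.
  move: relM; congr (vanishing f Z _); rewrite (mmap_unshear _ (in_alg {mpoly k[n]})) fcons0.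
  congr (_.[_]); apply: eq_map_poly => P; apply: eq_mmap => // j.
  by rewrite fconsS /= scale0r mul0r subr0 hw cast_ord_id.
case: (ex_minnP ex) => s /asboolP[G [G0 relG szG]] smin.
have [v tv] := mpoly_nonroot char0 (dehomogenized_top_neq0 G0).
have [c [c0 szS lS]] := mevalE_top tv.
exists G; split=> //.
pose z j := w j - v j *: l0.
have relE H : (map_poly (mmap (in_alg {mpoly k[n]}) z) (shear v H)).[l0] =
    mmap (in_alg {mpoly k[n]}) (fcons l0 w) H.
  rewrite (horner_shear v (in_alg {mpoly k[n]})); apply: eq_mmap => // i.
  by rewrite /fcons; case: unlift => // j; rewrite mulr_algl subrK.
have iz : alg_indep_fun (vanishing f Z) z.
  apply: (@sheared_alg_indep _ _ _ prZ _ w z l0 v (shear v G) c) => //.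
    by move=> j; rewrite subrK.
  by rewrite relE.
have minS := @minimal_relation k char0 _ _ prZ d z iz l0 v G c G0 lS c0.
have {}minS := minS (eq_ind_r (vanishing f Z) relG (relE G)).
have {}minS : forall M, M != 0 -> vanishing f Z (map_poly (mmap (in_alg {mpoly k[n]}) z) M).[l0] ->
    (size (shear v G) <= size M)%N.
  apply: minS => H H0; rewrite relE szG => relH; apply: smin; apply/asboolP.
  by exists H.
have {}relG : vanishing f Z (map_poly (mmap (in_alg {mpoly k[n]}) z) (shear v G)).[l0] by rewrite relE.
have linz j : linear_form (z j) by apply: linear_formB.
rewrite -szS -ltnS -(prednK (_ : 0 < size (shear v G))%N) ?ltnS; last first.
  by rewrite lt0n size_poly_eq0 shear_eq0.
exact: (generic_slice_degree_fun irrZ td degZ iz linz lS c0 relG minS).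
Qed.
End HypersurfaceBound.

Lemma msize_mmap_le (k : fieldType) m n (h : 'I_m -> {mpoly k[n]}) (P : {mpoly k[m]}) :
  (forall i, msize (h i) <= 2)%N -> (msize (mmap (@mpolyC n k) h P) <= msize P)%N.
Proof.
move=> hh; rewrite /mmap; apply: leq_trans (msize_sum _ _ _) _.
rewrite big_seq; apply/bigmax_leqP_seq => mo moP _.
apply: leq_trans (_ : (mdeg mo).+1 <= _)%N; last exact: msize_mdeg_lt.
have mulle (p q : {mpoly k[n]}) a b :
    (msize p <= a.+1 -> msize q <= b.+1 -> msize (p * q) <= (a + b).+1)%N.
  have [->|p0] := eqVneq p 0; first by rewrite mul0r mmeasure0.
  have [->|q0] := eqVneq q 0; first by rewrite mulr0 mmeasure0.
  by rewrite msizeM //; move: (msize p) (msize q) => c d; lia.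
rewrite mul_mpolyC; apply: leq_trans (msizeZ_le _ _) _; rewrite mdegE /mmap1.
apply: (big_ind2 (fun p a => (msize p <= a.+1)%N)) => [|p a q b|i _].
- by rewrite msize1.
- exact: mulle.
elim: (mo i) => [|e IH]; first by rewrite expr0 msize1.
by rewrite exprS; apply: (mulle _ _ 1%N e).
Qed.

(** The renamed polynomial is nonzero because a nonroot of [P], extended by 0 outside the range of
    [s], is a nonroot of it. *)
Lemma rename_relation (k : fieldType) (char0 : [pchar k] =i pred0) (B : comAlgType k)
    m n (u : 'I_m -> B) (v : 'I_n -> B) (s : 'I_m -> 'I_n) (P : {mpoly k[m]}) :
  injective s -> (forall i, v (s i) = u i) -> P != 0 ->
  exists Q : {mpoly k[n]}, [/\ Q != 0, (msize Q <= msize P)%N &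
    mmap (in_alg B) v Q = mmap (in_alg B) u P].
Proof.
move=> s_inj uv P0; exists (mmap (@mpolyC n k) (fun i => 'X_(s i)) P); split.
- have [a Pa] := mpoly_nonroot char0 P0; apply: contra_neq Pa => Q0.
  pose b i := \sum_(j | s j == i) a j.
  have := meval0 b; rewrite -{}Q0 (mmap_comp (meval b)) => e; rewrite -[RHS]e.
  apply: eq_mmap => [c|i] /=; first by rewrite mevalC.
  by rewrite mevalXU /b (big_pred1 i) // => j; apply: (inj_eq s_inj).
- by apply: msize_mmap_le => i; rewrite msizeX mdeg1.
- rewrite mmap_comp; apply: eq_mmap => [c|i] /=; first by rewrite mmapC.
  by rewrite mmapXU uv.
Qed.

(** * Removing transcendental elements from a relation *)

Section Peel.
Variables (k : fieldType) (B : comAlgType k) (I : B -> Prop) (prI : is_prime_ideal I).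
Let idI : is_ideal I. Proof. by case: prI. Qed.

(** The growth hypotheses make [y] transcendental over [L]: otherwise, cutting [Q] off after its
    last coefficient outside [I] would exhibit [y] as algebraic. *)
Lemma transcendental_coef (L : seq B) p y (Q : {poly {mpoly k[size L]}}) :
  growth I L p -> ~ growth I (y :: L) p -> I (map_poly (evs L) Q).[y] ->
  forall j, I (evs L Q`_j).
Proof.
move=> gL ngL IQ; apply: contrapT => /existsNP[j0 nj0].
have ex : exists j, `[< ~ I (evs L Q`_j) >] by exists j0; apply/asboolP.
have ub j : `[< ~ I (evs L Q`_j) >] -> (j <= size Q)%N.
  move=> /asboolP nj; rewrite leqNgt; apply/negP => ltj; apply: nj.
  by rewrite nth_default ?rmorph0 ?(ltnW ltj) //; apply: ideal0.
case: (ex_maxnP ex ub) => N /asboolP nN maxN.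
have IN j : (N < j)%N -> I (evs L Q`_j).
  by move=> ltj; apply: contrapT => nj; have := maxN j (asboolT nj); rewrite leqNgt ltj.
apply: ngL; apply: growth_algebraic => //.
exists N, (\max_(i < size Q) msize Q`_i), (fun j => evs L Q`_j); split=> //.
  move=> j; have [ltj|lej] := ltnP j (size Q); last first.
    by rewrite nth_default // rmorph0; apply: lspan0.
  apply: (lspan_sub prI _ (lspan_evs prI Q`_j)) => a; apply: monomials_le.
  exact: (leq_bigmax (F := fun i : 'I_(size Q) => msize Q`_i) (Ordinal ltj)).
move: IQ; rewrite (@horner_coef_wide _ (N.+1 + size Q)); last first.
  by apply: leq_trans (size_poly _ _) _; apply: leq_addl.
rewrite big_split_ord /= => IQ.
have -> : \sum_(j < N.+1) evs L Q`_j * y ^+ j =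
   (\sum_(i < N.+1) (map_poly (evs L) Q)`_i * y ^+ i + \sum_(i < size Q)
     (map_poly (evs L) Q)`_(N.+1 + i) * y ^+ (N.+1 + i)) -
   \sum_(i < size Q) (map_poly (evs L) Q)`_(N.+1 + i) * y ^+ (N.+1 + i).
  by rewrite addrK; apply: eq_bigr => i _; rewrite coef_map.
apply: idealB => //; apply: ideal_sum => // i _; apply: idealMr => //.
by rewrite coef_map; apply: IN; rewrite ltnS leq_addr.
Qed.

(** The growth hypotheses say that [ys] is independent over [F]. So the coefficients of [G] with
    respect to an element of [ys] are relations themselves, and the leading one is nonzero of no
    larger degree. *)
Lemma peel_relation (ys F : seq B) p e (G : {mpoly k[size (ys ++ F)]}) :
  growth I F p -> (forall t, growth I (ys ++ F) t -> (p + size ys <= t)%N) ->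
  G != 0 -> (msize G <= e)%N -> I (evs (ys ++ F) G) ->
  exists g : {mpoly k[size F]}, [/\ g != 0, (msize g <= e)%N & I (evs F g)].
Proof.
move=> gF; elim: ys G => [|y ys IH] G gG G0 szG IG; first by exists G.
have gys : growth I (ys ++ F) (p + size ys).
  elim: (ys) => [|y' ys' g']; first by rewrite addn0.
  by rewrite /= addnS; apply: growth_cons.
have ngy : ~ growth I (y :: ys ++ F) (p + size ys).
  by move=> /gG; rewrite /= addnS ltnn.
rewrite [evs _ _]evs_cons in IG.
have IQ := transcendental_coef gys ngy IG.
apply: (IH (lead_coef (shear (fun=> 0) G))).
- by move=> t /(growth_cons prI y)/gG; rewrite /= addnS ltnS.
- by rewrite lead_coef_eq0 shear_eq0.
- by rewrite (leq_trans _ szG) // lead_coefE msize_coef_shear.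
- by rewrite lead_coefE.
Qed.
End Peel.

(** * Every point lies on an irreducible component *)

Section Components.
Variables (k : fieldType) (K : closedFieldType) (f : {rmorphism k -> K}) (n : nat).
Implicit Types (X Z : set 'rV[K]_n).

Lemma alg_indep_size_le Z ws : is_prime_ideal (vanishing f Z) ->
  alg_indep (vanishing f Z) ws -> (size ws <= n)%N.
Proof.
move=> prZ iw; have e : size (coords k n) = n by rewrite size_map size_enum_ord.
rewrite -{2}e; apply: (alg_indep_growth prZ (growth_size prZ (coords k n))) iw.
by apply: (gen_xs_uniform prZ); apply: coords_gen.
Qed.

(** A variety over [k] through [x] contains the whole closure, so in a decomposition the part
    through [x] is everything. *)
Lemma point_closure_irreducible (x : 'rV[K]_n) :
  irreducible f [set y : 'rV[K]_n | forall p, mmap f (x 0) p = 0 -> mmap f (y 0) p = 0].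
Proof.
set Z := [set y | _]; have Zx : Z x by [].
split; [ | by exists x | move=> Y1 Y2 vY1 vY2 eZ].
  apply/affine_varietyP => y hy p px; apply: hy => z; exact.
have sub Y : affine_variety f Y -> Y x -> Y `<=` Z -> Z = Y.
  move=> /affine_varietyP vY Yx YZ; apply/seteqP; split=> // y Zy.
  by apply: vY => p hp; apply/Zy/hp.
have : (Y1 `|` Y2) x by rewrite -eZ.
by case=> Yx; [left | right]; apply: sub => //; rewrite eZ; [apply: subsetUl | apply: subsetUr].
Qed.

(** Among the irreducible subvarieties through [x], one with the longest independent family is
    maximal by [alg_indep_step]. The bound [n] on these lengths takes the place of Zorn's lemma. *)
Lemma in_irreducible_component X x : affine_variety f X -> X x ->
  exists2 Z, irreducible_component f X Z & Z x.
Proof.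
move=> vX Xx.
pose P p := `[< exists Z ws, [/\ irreducible f Z, Z `<=` X, Z x,
  alg_indep (vanishing f Z) ws & size ws = p] >].
have exP : exists p, P p.
  exists 0%N; apply/asboolP; exists [set y : 'rV[K]_n | forall p, mmap f (x 0) p = 0 -> mmap f (y 0) p = 0], [::].
  have irr := point_closure_irreducible x; split=> //.
    move=> y hy; move/affine_varietyP: vX; apply=> p hp; apply/hy/hp/Xx.
  exact/alg_indep_nil/irreducible_prime.
have ubP p : P p -> (p <= n)%N.
  by move=> /asboolP[Z [ws [irr _ _ iw <-]]]; apply: alg_indep_size_le iw; apply: irreducible_prime.
case: (ex_maxnP exP ubP) => p /asboolP[Z [ws [irr ZX Zx iw sw]]] pmax.
exists Z => //; split=> // Z' irr' Z'X ZZ'; apply/seteqP; split=> //.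
apply: contrapT => nsub; have [vZ _ _] := irr.
have [h hZ nhZ'] := variety_separate vZ nsub.
have ihw := alg_indep_step (irreducible_prime irr') ZZ' hZ nhZ' iw.
suff : (p.+1 <= p)%N by rewrite ltnn.
apply: pmax; apply/asboolP; exists Z', (h :: ws); split=> //; last by rewrite /= sw.
exact: ZZ'.
Qed.
End Components.

(** * Exceptional points of the projection *)

Lemma pigeonhole_nat (U : finType) (h : nat -> U) q :
  exists (b : U) (t : 'I_q -> nat), injective t /\ forall i, h (t i) = b.
Proof.
pose N := (q * #|U|).+1.
have [b hb] : exists b, (q <= #|[pred i : 'I_N | h i == b]|)%N.
  apply: contrapT => nex.
  have lt b : (#|[pred i : 'I_N | h i == b]| <= q)%N.
    by rewrite leqNgt; apply/negP => lt; apply: nex; exists b; apply: ltnW.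
  have : (\sum_(b : U) #|[pred i : 'I_N | h i == b]| <= q * #|U|)%N.
    by rewrite mulnC -sum_nat_const; apply: leq_sum.
  rewrite (_ : (\sum_(b : U) _)%N = N) ?ltnn //.
  rewrite -[RHS]card_ord -sum1_card (partition_big (fun i : 'I_N => h i) xpredT) //=.
  by apply: eq_bigr => b _; rewrite -sum1_card.
have sz : size (enum [pred i : 'I_N | h i == b]) = #|[pred i : 'I_N | h i == b]| by rewrite -cardE.
have lt_i (i : 'I_q) : (i < #|[pred i : 'I_N | h i == b]|)%N by apply: leq_trans hb.
exists b, (fun i => nat_of_ord (enum_val (Ordinal (lt_i i)))); split.
  by move=> i j /val_inj /enum_val_inj [] /val_inj.
by move=> i; have := enum_valP (Ordinal (lt_i i)); rewrite inE => /eqP.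
Qed.

Section BaseRelation.
Variables (k : fieldType) (char0 : [pchar k] =i pred0).
Variables (K : closedFieldType) (f : {rmorphism k -> K}) (n : nat).
Variables (Z : set 'rV[K]_n) (e : nat) (irrZ : irreducible f Z).
Hypothesis degZ : has_irreducible_degree f Z e.
Let prZ : is_prime_ideal (vanishing f Z). Proof. exact: irreducible_prime. Qed.

Lemma trdeg_exists : exists d, trdeg (vanishing f Z) (coords k n) d.
Proof. exact: trdeg_ex prZ _. Qed.

Lemma coords_linear p : p \in coords k n -> linear_form p.
Proof. by move=> /mapP[i _ ->]; apply: linear_formX. Qed.

(** [hypersurface_degree] requires a full transcendence basis. A maximal independent part [ws] of
    [bs] is therefore completed by coordinates [ys]. As [l0] in [bs] is algebraic over [ws], the
    [ys] are still independent over [l0 :: ws] and can be peeled off without raising the degree. *)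
Lemma base_relation (bs : seq {mpoly k[n]}) (P : {mpoly k[size bs]}) :
  uniq bs -> (forall b, b \in bs -> linear_form b) -> P != 0 ->
  vanishing f Z (evs bs P) ->
  exists g : {mpoly k[size bs]}, [/\ g != 0, (msize g <= e.+1)%N & vanishing f Z (evs bs g)].
Proof.
move=> ubs linb P0 hP.
have [ws [sub iw gw]] := alg_indep_extend prZ bs (alg_indep_nil prZ).
rewrite !cats0 in iw gw.
have [le_s eq_s] := size_subseq_leqif sub.
have lt_s : (size ws < size bs)%N.
  rewrite ltn_neqAle le_s andbT eq_s; apply/eqP => ews; move: iw; rewrite ews => iw.
  by move/eqP: P0; apply; apply: iw.
have [l0 l0b l0w] : exists2 l0, l0 \in bs & l0 \notin ws.
  apply: contrapT => nex; move: lt_s; rewrite ltnNge uniq_leq_size // => b bb.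
  by apply: contraT => bw; case: nex; exists b.
have gF : growth (vanishing f Z) (l0 :: ws) (size ws).
  apply: (growth_sub prZ (D := 1) _ gw) => b hb; apply: (lspan_mem prZ).
  rewrite -[b]mulr1; apply: monomialsM; last exact: monomials1.
  by move: hb; rewrite inE => /orP[/eqP -> //|]; apply: mem_subseq.
have [d td] := trdeg_exists.
have [ys [sub_ys iy sy]] := trdeg_basis prZ (coords_gen prZ) td iw.
rewrite -sy in td.
have linw (j : 'I_(size (ys ++ ws))) : linear_form (ys ++ ws)`_j.
  have := mem_nth 0 (ltn_ord j); rewrite mem_cat => /orP[/(mem_subseq sub_ys)|/(mem_subseq sub)].
    exact: coords_linear.
  exact: linb.
have [G [G0 szG relG]] := hypersurface_degree char0 irrZ td degZ iy linw (linb _ l0b).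
have eF : (size (ys ++ ws)).+1 = size (ys ++ l0 :: ws) by rewrite !size_cat /= addnS.
have lt_h : (size ys < (size (ys ++ ws)).+1)%N by rewrite size_cat ltnS leq_addr.
pose h := Ordinal lt_h.
(* [l0] comes first in the relation obtained; this moves it between [ys] and [ws]. *)
pose s i := cast_ord eF (fcons h (lift h) i).
have s_inj : injective s.
  move=> i j /cast_ord_inj; rewrite /fcons.
  case: unliftP => [i' ->|->]; case: unliftP => [j' ->|->] //.
  - by move/lift_inj ->.
  - by move=> eij; have := neq_lift h i'; rewrite eij eqxx.
  - by move=> eij; have := neq_lift h j'; rewrite -eij eqxx.
have hs i : (ys ++ l0 :: ws)`_(s i) =
    fcons l0 (fun j : 'I_(size (ys ++ ws)) => (ys ++ ws)`_j) i.
  rewrite /s /fcons /=; case: unliftP => [j|] _ /=; last by rewrite nth_cat ltnn subnn.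
  rewrite !nth_cat /bump; case: (leqP (size ys) j) => lej; last by rewrite add0n lej.
  by rewrite add1n ltnNge leqW //= subSn.
have [G' [G'0 szG' eG']] := rename_relation char0 (B := {mpoly k[n]})
  (v := fun i : 'I_(size (ys ++ l0 :: ws)) => (ys ++ l0 :: ws)`_i) s_inj hs G0.
rewrite -eG' in relG.
have gt_F t : growth (vanishing f Z) (ys ++ l0 :: ws) t -> (size ws + size ys <= t)%N.
  move=> gt; suff : (size (ys ++ ws) <= t)%N by rewrite size_cat addnC.
  apply: (alg_indep_growth prZ gt) iy; exists 1%N => b hb; apply: (lspan_mem prZ).
  rewrite -[b]mulr1; apply: monomialsM; last exact: monomials1.
  by move: hb; rewrite !mem_cat inE => /orP[->|->]; rewrite ?orbT.
have [g [g0 szg relg]] := peel_relation prZ gF gt_F G'0 (leq_trans szG' szG) relG.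
have Fb (i : 'I_(size (l0 :: ws))) : (l0 :: ws)`_i \in bs.
  by have := mem_nth 0 (ltn_ord i); rewrite inE => /orP[/eqP -> //|/(mem_subseq sub)].
have lt_i (i : 'I_(size (l0 :: ws))) : (index ((l0 :: ws)`_i)%R bs < size bs)%N by rewrite index_mem.
have s'_inj : injective (fun i => Ordinal (lt_i i)).
  move=> i j /(congr1 val) /= eij; apply/val_inj/eqP.
  rewrite -(nth_uniq 0 (ltn_ord i) (ltn_ord j)) ?(subseq_uniq sub) ?l0w //=.
    by rewrite -(nth_index 0 (Fb i)) eij nth_index.
  by rewrite l0w (subseq_uniq sub).
have hs' i : bs`_(Ordinal (lt_i i)) = (l0 :: ws)`_i by rewrite /= nth_index.
have [g' [g'0 szg' eg']] := rename_relation char0 (B := {mpoly k[n]})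
  (v := fun i : 'I_(size bs) => bs`_i) s'_inj hs' g0.
exists g'; split=> //; first exact: leq_trans szg' szg.
by rewrite /evs eg'.
Qed.
End BaseRelation.

(** Values indexed by all naturals can be concatenated and shifted by plain arithmetic, without
    casts between ordinals. *)
Definition extend_by0 (k : fieldType) m (u : 'I_m -> k) (j : nat) : k :=
  if insub j is Some j' then u j' else 0.

Lemma extend_by0E (k : fieldType) m (u : 'I_m -> k) (j : 'I_m) : extend_by0 u j = u j.
Proof. by rewrite /extend_by0 valK. Qed.

(** * Fibers of a dominating component *)

Section DominantFiber.
Variables (k : fieldType) (char0 : [pchar k] =i pred0).
Variables (K : closedFieldType) (f : {rmorphism k -> K}) (n : nat).
Variables (Z : set 'rV[K]_n) (e : nat) (irrZ : irreducible f Z).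
Hypothesis degZ : has_irreducible_degree f Z e.
Let prZ : is_prime_ideal (vanishing f Z). Proof. exact: irreducible_prime. Qed.

Lemma dominant_fiber q (y : 'I_q -> {mpoly k[n]}) (bs : seq {mpoly k[n]})
    (T : finType) (io : T -> k) :
  (forall j, linear_form (y j)) -> (forall b, b \in bs -> linear_form b) ->
  (forall i, (exists j, 'X_i = y j) \/ 'X_i \in bs) ->
  alg_indep (vanishing f Z) bs -> injective io ->
  exists bad : {set {ffun 'I_(size bs) -> T}},
    (#|bad| * #|T| <= e * #|T| ^ size bs)%N /\
    forall a, a \notin bad -> exists2 x : 'rV[K]_n, Z x &
      forall j : 'I_(size bs), mmap f (x 0) bs`_j = f (io (a j)).
Proof.
move=> liny linb hX ib io_inj.
have [d td] := trdeg_exists irrZ.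
have [ys [sub_ys iy sy]] := trdeg_basis prZ (coords_gen prZ) td ib.
rewrite -sy in td; set L := ys ++ bs in iy sy td.
have szL : size L = (size ys + size bs)%N by rewrite size_cat.
have linL (j : 'I_(size L)) : linear_form L`_j.
  have := mem_nth 0 (ltn_ord j); rewrite mem_cat => /orP[/(mem_subseq sub_ys)|].
    exact: coords_linear.
  exact: linb.
pose tau (i : nat) : k := i%:R.
pose t i := \sum_(j < q) tau i ^+ j *: y j.
have hQ i : exists Q : {poly {mpoly k[size L]}}, [/\ Q != 0,
    (msize (lead_coef Q) <= e.+1)%N & vanishing f Z (map_poly (evs L) Q).[t i]].
  have lint : linear_form (t i) by apply: linear_form_sum.
  have [G [G0 szG relG]] := hypersurface_degree char0 irrZ td degZ iy linL lint.
  exists (shear (fun=> 0) G); split; first by rewrite shear_eq0.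
    by apply: leq_trans szG; rewrite lead_coefE msize_coef_shear.
  move: relG; congr (vanishing f Z _); rewrite (horner_shear _ (in_alg {mpoly k[n]})).
  apply: eq_mmap => // j; rewrite /fcons; case: unlift => //= j'.
  by rewrite scale0r mul0r addr0.
have {hQ} [Q hQ] := choice hQ.
pose lc i := lead_coef (Q i).
have lc0 i : lc i != 0 by rewrite lead_coef_eq0; case: (hQ i).
pose v (u w : nat -> k) (i : 'I_(size L)) :=
  if (i < size ys)%N then u i else w (i - size ys)%N.
(* Quantifying over the values [u] of the remaining basis elements makes [bad i] depend on the index
   alone, as the pigeonhole requires. *)
pose bad i := [set a : {ffun 'I_(size bs) -> T} |
  `[< forall u, (lc i).@[v u (extend_by0 (io \o a))] = 0 >]]%SET.
have card_bad i : (#|bad i| * #|T| <= e * #|T| ^ size bs)%N.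
  (* Fixing [ys] at the values from a nonroot leaves a nonzero polynomial in the base coordinates
     that vanishes at every bad point. *)
  have [v0 hv0] := mpoly_nonroot char0 (lc0 i).
  pose P := mmap (@mpolyC (size bs) k) (fun i : 'I_(size L) =>
    if (i < size ys)%N then (v0 i)%:MP else
    if insub (i - size ys)%N is Some j then 'X_j else 0) (lc i).
  have evP u : P.@[u] = (lc i).@[v (extend_by0 v0) (extend_by0 u)].
    rewrite /P (mmap_comp (meval u)); apply: eq_mmap => [c|j] /=; first by rewrite mevalC.
    rewrite /v; case: ifP => _; first by rewrite mevalC extend_by0E.
    by rewrite /extend_by0; case: insub => [j'|]; rewrite ?mevalXU ?meval0.
  have P0 : P != 0.
    apply: contra_neq hv0 => P0.
    have := evP (fun j => extend_by0 v0 (size ys + j)); rewrite P0 meval0 => ->.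
    apply: meval_eq => j; rewrite /v; case: ltnP => lej; first by rewrite extend_by0E.
    have ltj : (j - size ys < size bs)%N by have := ltn_ord j; rewrite {2}szL; lia.
    by rewrite /extend_by0 (insubT (fun j => j < size bs)%N ltj) /= subnKC // valK.
  have szP : (msize P <= e.+1)%N.
    apply: leq_trans (_ : msize (lc i) <= _)%N; last by case: (hQ i).
    apply: msize_mmap_le => j; case: ifP => _; first by rewrite msizeC; case: (_ != 0).
    by case: insub => [j'|]; rewrite ?msizeX ?mdeg1 ?mmeasure0.
  apply: leq_trans (leq_trans (schwartz_zippel io_inj P0) _).
    rewrite leq_mul2r; apply/orP; right; apply/subset_leq_card/fintype.subsetP => a.
    by rewrite !inE => /asboolP h; rewrite evP h.
  by rewrite leq_mul2r; apply/orP; right; move: szP; move: (msize P) => s; lia.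
(* One more index than the [q] needed, so that there is an index to bound [#|b|] even when
   [q = 0]. *)
have [b [s [s_inj bad_s]]] := pigeonhole_nat bad q.+1.
exists b; split; first by rewrite -(bad_s ord0).
move=> a ab; pose w := extend_by0 (io \o a).
have hu (j : 'I_q.+1) : exists u, (lc (s j)).@[v u w] != 0.
  apply: contrapT => nex; move: ab; rewrite -(bad_s j) inE => /negP; apply; apply/asboolP => u.
  by apply: contrapT => /eqP hu; apply: nex; exists u.
(* Each chosen index has its own good [u]; a nonroot of the product of the restricted leading
   coefficients serves all of them. *)
have [u hlc] : exists u, forall j : 'I_q.+1, (lc (s j)).@[v u w] != 0.
  pose R j := mmap (@mpolyC (size ys) k) (fun i : 'I_(size L) =>
    if insub (nat_of_ord i) is Some i' then 'X_i' else (w (i - size ys)%N)%:MP) (lc (s j)).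
  have evR j u : (R j).@[u] = (lc (s j)).@[v (extend_by0 u) w].
    rewrite /R (mmap_comp (meval u)); apply: eq_mmap => [c|i] /=; first by rewrite mevalC.
    rewrite /v /extend_by0; case: insubP => [i' -> _|/negPf ->]; last by rewrite mevalC.
    by rewrite mevalXU.
  have R0 : \prod_j R j != 0.
    apply/prodf_neq0 => j _; have [u hju] := hu j; apply: contra_neq hju => Rj0.
    have := evR j (fun i => u i); rewrite Rj0 meval0 => ->; apply: meval_eq => i.
    rewrite /v; case: ifP => // lti.
    by rewrite /extend_by0 (insubT (fun i => i < size ys)%N lti).
  have [u] := mpoly_nonroot char0 R0; rewrite rmorph_prod => /prodf_neq0 hR.
  by exists (extend_by0 u) => j; rewrite -evR; apply: hR.
pose z0 := v u w.
have tau_inj : injective (fun j : 'I_q.+1 => tau (s j)).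
  by move=> i j /(natr_inj_char0 char0)/s_inj.
have [lam hlam] := lagrange_coef tau_inj.
pose ts := [seq t (s j) | j <- enum 'I_q.+1].
have szts : size ts = q.+1 by rewrite size_map size_enum_ord.
have tsE (j : 'I_(size ts)) : ts`_j = t (s (cast_ord szts j)).
  have ltj : (j < q.+1)%N := ltn_ord (cast_ord szts j).
  rewrite (nth_map ord0) ?size_enum_ord //.
  by have -> : nth ord0 (enum 'I_q.+1) j = cast_ord szts j by apply/val_inj; rewrite /= nth_enum_ord.
(* The forms [t] are values of a polynomial in tau with coefficients [y], recovered by
   interpolation; [widen_ord] supplies the extra, absent coefficient. *)
have yE (i : 'I_q) : y i = \sum_j lam (widen_ord (leqnSn q) i) (cast_ord szts j) *: ts`_j.
  under eq_bigr do rewrite tsE.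
  rewrite (reindex (cast_ord (esym szts))) /=; last first.
    by exists (cast_ord szts) => j _; rewrite ?cast_ordK ?cast_ordKV.
  under eq_bigr do rewrite cast_ordKV /t scaler_sumr.
  rewrite exchange_big (bigD1 i) //= [X in _ + X]big1 => [|l ne].
    under eq_bigr do rewrite scalerA.
    have := hlam (widen_ord (leqnSn q) i) (widen_ord (leqnSn q) i).
    by rewrite eqxx -scaler_suml addr0 => -> ; rewrite scale1r.
  under eq_bigr do rewrite scalerA.
  have := hlam (widen_ord (leqnSn q) i) (widen_ord (leqnSn q) l).
  rewrite (inj_eq (_ : injective (widen_ord _))); last first.
    by move=> i1 i2 /(congr1 val) /= ei; apply/val_inj.
  by rewrite (negPf ne) -scaler_suml => ->; rewrite scale0r.
have [||||||x [xZ xa]] := @lift_point k K f n (vanishing f Z) _ {mpoly k[size L]}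
  (@mpolyC _ k) (evs L) (mmap f (f \o z0)) _ _ ts.
- exact: vanishing_ideal.
- by move=> c /=; rewrite /evs mmapC /= alg_mpolyC.
- by move=> c /=; rewrite mmapC.
- by move=> p /iy ->; rewrite rmorph0.
- move=> _ /mapP[j _ ->]; exists (Q (s j)), (size (Q (s j))).-1; split=> //.
  + by case: (hQ (s j)).
  + exact: leqSpred.
  + by rewrite -lead_coefE /= mmap_meval fmorph_eq0; apply: hlc.
(* A variable is some [y j], hence a combination of [ts], or it belongs to [bs], hence to the image
   of [evs L]. *)
- move=> i; case: (hX i) => [[j ->]|ib'].
    exists 0, (fun l => lam (widen_ord (leqnSn q) j) (cast_ord szts l)).
    by rewrite rmorph0 add0r yE.
  have lti : (size ys + index 'X_i bs < size L)%N by rewrite szL ltn_add2l index_mem.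
  exists 'X_(Ordinal lti), (fun=> 0); rewrite big1 => [|j _]; last by rewrite scale0r.
  by rewrite addr0 /= /evs mmapXU /= nth_cat ltnNge leq_addr /= addKn nth_index.
have eqx p : mmap f ((\row_i x i) 0) p = mmap f x p by apply: eq_mmap => // j; rewrite mxE.
exists (\row_i x i).
  by have [/affine_varietyP vZ _ _] := irrZ; apply: vZ => p hp; rewrite eqx xZ.
move=> j; have ltj : (size ys + j < size L)%N by rewrite szL ltn_add2l.
rewrite eqx; have := xa 'X_(Ordinal ltj).
rewrite /= /evs mmapXU /= nth_cat ltnNge leq_addr /= addKn => ->.
by rewrite mmapXU /= /z0 /v /= ltnNge leq_addr /= addKn /w extend_by0E.
Qed.
End DominantFiber.

Section FunctionFamilies.
Variables (k : fieldType) (char0 : [pchar k] =i pred0).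
Variables (K : closedFieldType) (f : {rmorphism k -> K}) (n : nat).
Variables (Z : set 'rV[K]_n) (e : nat) (irrZ : irreducible f Z).
Hypothesis degZ : has_irreducible_degree f Z e.

Lemma base_relation_fun m (A : 'I_m -> {mpoly k[n]}) (P : {mpoly k[m]}) :
  injective A -> (forall j, linear_form (A j)) -> P != 0 ->
  vanishing f Z (mmap (in_alg {mpoly k[n]}) A P) ->
  exists g : {mpoly k[m]}, [/\ g != 0, (msize g <= e.+1)%N &
    vanishing f Z (mmap (in_alg {mpoly k[n]}) A g)].
Proof.
have [bs [em hA]] := seq_of_fun A; case: m / em A hA P => A hA P A_inj linA P0 relP.
have evA p : mmap (in_alg {mpoly k[n]}) A p = evs bs p.
  by apply: eq_mmap => // j; rewrite hA cast_ord_id.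
have ubs : uniq bs.
  apply/(uniqP 0) => i j lti ltj.
  rewrite (hA (Ordinal lti)) (hA (Ordinal ltj)) !cast_ord_id.
  by move/A_inj/(congr1 val).
have linb b : b \in bs -> linear_form b.
  by move=> /(nthP 0)[i lti <-]; rewrite (hA (Ordinal lti)).
rewrite evA in relP.
have [g [g0 szg relg]] := base_relation char0 irrZ degZ ubs linb P0 relP.
by exists g; rewrite evA.
Qed.

Lemma dominant_fiber_fun q (y : 'I_q -> {mpoly k[n]}) m (A : 'I_m -> {mpoly k[n]})
    (T : finType) (io : T -> k) :
  (forall j, linear_form (y j)) -> (forall j, linear_form (A j)) ->
  (forall i, (exists j, 'X_i = y j) \/ exists j, 'X_i = A j) ->
  alg_indep_fun (vanishing f Z) A -> injective io ->
  exists bad : {set {ffun 'I_m -> T}},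
    (#|bad| * #|T| <= e * #|T| ^ m)%N /\
    forall a, a \notin bad -> exists2 x : 'rV[K]_n, Z x &
      forall j, mmap f (x 0) (A j) = f (io (a j)).
Proof.
have [bs [em hA]] := seq_of_fun A; case: m / em A hA => A hA liny linA hX iA io_inj.
have [|i||bad [cb hb]] := dominant_fiber (bs := bs) char0 irrZ degZ liny _ _ _ io_inj.
- by move=> b /(nthP 0)[i lti <-]; rewrite (hA (Ordinal lti)).
- case: (hX i) => [|[j ->]]; [by left | right].
  by rewrite -(cast_ord_id erefl j) -hA mem_nth.
- exact: (alg_indep_seq_of_fun hA).
exists bad; split=> // a /hb[x Zx hx]; exists x => // j.
by rewrite -hx hA cast_ord_id.
Qed.
End FunctionFamilies.

(** * Dominance of the projection and the count of exceptional points *)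

Section Projection.
Variables (k : fieldType) (char0 : [pchar k] =i pred0).
Variables (K : closedFieldType) (f : {rmorphism k -> K}) (q r : nat).
Implicit Types (X Z : set 'rV[K]_(q + r)) (S : {fset k}).

Definition base_coord (j : 'I_r) : {mpoly k[q + r]} := 'X_(rshift q j).

Lemma mmap_projection (x : 'rV[K]_(q + r)) (p : {mpoly k[r]}) :
  mmap f (projection x 0) p = mmap f (x 0) (mmap (in_alg {mpoly k[q + r]}) base_coord p).
Proof.
rewrite [RHS](mmap_comp (mmap f (x 0))); apply: eq_mmap => [c|j] /=.
  by rewrite alg_mpolyC mmapC.
by rewrite mmapXU /projection mxE.
Qed.

Lemma mmap_grid_point S (a : {ffun 'I_r -> S}) (p : {mpoly k[r]}) :
  mmap f (grid_point f a 0) p = f p.@[val \o a].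
Proof. by rewrite -mmap_meval; apply: eq_mmap => // j; rewrite mxE. Qed.

(** A nonzero [p] has a nonroot in k^r, so a nonzero relation among the base coordinates confines
    the image to a proper subvariety. *)
Lemma projection_dominantP X : projection_dominant f X <->
  forall p : {mpoly k[r]},
    vanishing f X (mmap (in_alg {mpoly k[q + r]}) base_coord p) -> p = 0.
Proof.
split=> [dom p hp|h].
  apply/eqP; apply: contraT => /(mpoly_nonroot char0)[v].
  have cl : zariski_closure f (@projection K q r @` X) (\row_j f (v j)) by rewrite dom.
  have /= : [set y : 'rV[K]_r | mmap f (y 0) p = 0] (\row_j f (v j)).
    apply: cl; first by apply/affine_varietyP => y; apply; exact.
    by move=> _ [x Xx <-] /=; rewrite mmap_projection hp.
  have -> : mmap f ((\row_j f (v j)) 0) p = f p.@[v].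
    by rewrite -mmap_meval; apply: eq_mmap => // j; rewrite mxE.
  by move/eqP; rewrite fmorph_eq0 => ->.
apply/seteqP; split=> // y _ Y vY XY; move/affine_varietyP: vY; apply=> p hp.
rewrite [p]h ?rmorph0 // => x Xx; rewrite -mmap_projection; apply: hp; apply: XY.
by exists x.
Qed.

Lemma nondominant_component Z e S : irreducible f Z -> has_irreducible_degree f Z e ->
  ~ alg_indep_fun (vanishing f Z) base_coord ->
  exists bad : {set {ffun 'I_r -> S}}, (#|bad| * #|` S| <= e * #|` S| ^ r)%N /\
    forall a, fiber Z (grid_point f a) !=set0 -> a \in bad.
Proof.
move=> irrZ degZ /existsPNP[P0 relP0 /eqP P00].
have [g [g0 szg relg]] : exists g : {mpoly k[r]}, [/\ g != 0, (msize g <= e.+1)%N &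
    vanishing f Z (mmap (in_alg {mpoly k[q + r]}) base_coord g)].
  apply: (base_relation_fun char0 irrZ degZ) P00 relP0.
    move=> i j /(congr1 (mcoeff U_(rshift q i))).
    rewrite !mcoeffX eqxx eq_mnm1; case: eqP => [/rshift_inj -> //|_ /eqP].
    by rewrite oner_eq0.
  by move=> j; apply: linear_formX.
exists [set a : {ffun 'I_r -> S} | g.@[val \o a] == 0%R]%SET; split.
  have := schwartz_zippel (io := fun s : S => val s) val_inj g0.
  rewrite cardfE => /leq_trans; apply; rewrite leq_mul2r; apply/orP; right.
  by move: szg; move: (msize g) => s; lia.
move=> a [x [xa Zx]]; rewrite inE; apply/eqP/(fmorph_inj f).
by rewrite -mmap_grid_point -xa mmap_projection relg // rmorph0.
Qed.

Lemma dominant_component Z e S : irreducible f Z -> has_irreducible_degree f Z e ->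
  alg_indep_fun (vanishing f Z) base_coord ->
  exists bad : {set {ffun 'I_r -> S}}, (#|bad| * #|` S| <= e * #|` S| ^ r)%N /\
    forall a, a \notin bad -> fiber Z (grid_point f a) !=set0.
Proof.
move=> irrZ degZ ib.
have [||||bad [cb hb]] := dominant_fiber_fun (T := S) (io := val) char0 irrZ degZ
  (y := fun i => 'X_(lshift r i)) (A := base_coord) _ _ _ ib _.
- by move=> j; apply: linear_formX.
- by move=> j; apply: linear_formX.
- move=> i; rewrite -(splitK i); case: (split i) => j; [left | right]; by exists j.
- exact: val_inj.
exists bad; rewrite cardfE; split=> // a /hb[x Zx hx]; exists x; split=> //.
apply/rowP => j; rewrite !mxE -hx /base_coord mmapXU.
by [].
Qed.
End Projection.

Theorem proposition5 (k : fieldType) (char0 : [pchar k] =i pred0)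
    (K : closedFieldType) (f : {rmorphism k -> K})
    (closure_f : is_algebraic_closure f)
    (q r : nat) (X : set 'rV[K]_(q + r)) (varX : affine_variety f X)
    (S : {fset k}) (S_neq0 : S != fset0)
    (degX : nat) (degXP : has_degree f X degX) :
  (1 - degX%:R / (#|` S|)%:R) * (#|` S|)%:R ^+ r
    <= (#|good_points f X S|)%:R :> rat.
Proof.
have [m [C [e [_ compC degC ->]]]] := degXP.
have irrC i : irreducible f (C i) by have /compC[] : exists j, C i = C j by exists i.
have CX i : C i `<=` X by have /compC[] : exists j, C i = C j by exists i.
have [bad [card_bad hbad]] : exists bad : {set {ffun 'I_r -> S}},
    (#|bad| * #|` S| <= (\sum_i e i) * #|` S| ^ r)%N /\ forall a, a \notin bad ->
      (projection_dominant f X <-> fiber X (grid_point f a) !=set0).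
  (* If one component is dominant then so is [X], and the exceptional set of that component
     suffices. Otherwise all components contribute, whence the sum of their degrees. *)
  have [[i ind]|dep] := pselect (exists i,
      alg_indep_fun (vanishing f (C i)) (@base_coord k q r)).
    have [bad [cb hb]] := dominant_component char0 S (irrC i) (degC i) ind.
    exists bad; split.
      by rewrite (leq_trans cb) // leq_mul2r (bigD1 i) //= leq_addr orbT.
    move=> a /hb[x [xa Cx]]; split=> _; first by exists x; split=> //; apply: CX Cx.
    apply/(projection_dominantP char0) => p hp; apply: ind; apply: vanishing_sub hp; exact: CX.
  have hi i : exists bad : {set {ffun 'I_r -> S}}, (#|bad| * #|` S| <= e i * #|` S| ^ r)%N /\
      forall a, fiber (C i) (grid_point f a) !=set0 -> a \in bad.
    by apply: nondominant_component (irrC i) (degC i) _ => // h; apply: dep; exists i.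
  have {hi} [bad hb] := choice hi.
  exists (\big[@finset.setU _/finset.set0]_i bad i); split.
    apply: (@leq_trans (\sum_i (#|bad i| * #|` S|))); last first.
      by rewrite big_distrl /=; apply: leq_sum => i _; case: (hb i).
    rewrite -big_distrl leq_mul2r; apply/orP; right.
    elim/big_rec2: _ => [|i s B _ leB]; first by rewrite cards0.
    by rewrite (leq_trans (leq_card_setU _ _).1) // leq_add2l.
  move=> a a_bad; have nC i : ~ (fiber (C i) (grid_point f a) !=set0).
    have [_ h] := hb i; move=> /h ai; case/negP: a_bad; apply/finset.bigcupP; exists i => //.
  split=> [dom|[x [xa Xx]]].
    have hg i : exists p : {mpoly k[r]}, p != 0 /\
        vanishing f (C i) (mmap (in_alg {mpoly k[q + r]}) (@base_coord k q r) p).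
      have /existsPNP[p relp /eqP p0] : ~ alg_indep_fun (vanishing f (C i)) (@base_coord k q r).
        by move=> h; apply: dep; exists i.
      by exists p.
    have {hg} [g hg] := choice hg.
    (* Every point of [X] lies on a component, so the product of the relations vanishes on [X],
       against dominance. *)
    have /eqP : \prod_i g i = 0.
      move/(projection_dominantP char0): dom; apply=> x Xx.
      have [Z /compC[i eZ] Zx] := in_irreducible_component varX Xx; subst Z.
      rewrite (bigD1 i) //= rmorphM rmorphM /=.
      by case: (hg i) => _ ->; rewrite ?mul0r.
    by rewrite prodf_seq_eq0 => /hasP[i _]; case: (hg i) => /negPf ->.
  have [Z /compC[i eZ] Zx] := in_irreducible_component varX Xx; subst Z.
  by case: (nC i); exists x.
have S0 : (0 < #|` S|)%N by rewrite cardfs_gt0.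
have cardT : (#|good_points f X S| + #|bad| >= #|` S| ^ r)%N.
  have -> : (#|` S| ^ r)%N = #|[set: {ffun 'I_r -> S}]%SET|.
    by rewrite cardsT card_ffun card_ord cardfE.
  apply: leq_trans (leq_card_setU _ _).1; apply/subset_leq_card/fintype.subsetP => a _.
  rewrite !inE; case: (boolP (a \in bad)) => [|/hbad h]; rewrite ?orbT ?orbF //.
  exact/asboolP.
set N := #|` S| in card_bad S0 cardT *; set D := (\sum_i e i)%N in card_bad *.
have N0 : (0 : rat) < N%:R by rewrite ltr0n.
have bD : (#|bad|%:R : rat) <= D%:R / N%:R * N%:R ^+ r.
  by rewrite mulrAC ler_pdivlMr // -natrX -!natrM ler_nat.
rewrite mulrBl mul1r lerBlDr; apply: le_trans (lerD (lexx _) bD).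
by rewrite -natrX -natrD ler_nat.
Qed.
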